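(* Fix an integer $p\ge3$ and suppose $(\beta,h)\in\Theta=[0,\infty)\times\mathbb{R}$ is $p$-regular. Assume $h$ is known, $\boldsymbol\sigma\sim\mathbb{P}_{\beta,h,p}$, and let $\hat\beta_N$ be the maximum likelihood estimate of $\beta$. Let $m_*=m_*(\beta,h,p)$ be the unique global maximizer of $H=H_{\beta,h,p}$. Then: - If $m_*\ne0$, then, as $N\to\infty$, $$N^{1/2}(\hat\beta_N-\beta)\xrightarrow{D}N\left(0,-\frac{H''(m_* )}{p^2m_*^{2p-2}}\right).$$ - If $m_*=0$ (equivalently, $h=0$ and $\beta<\tilde\beta_p$), then, as $N\to\infty$, $$\hat\beta_N\xrightarrow{D}\begin{cases}\frac12\delta_{\tilde\beta_p}+\frac12\delta_{-\tilde\beta_p}&\text{if }p\text{ is odd},\\ \gamma_p\delta_{-\infty}+(1-\gamma_p)\delta_{\tilde\beta_p}&\text{if }p\text{ is even},\end{cases}$$ where $\gamma_p=\mathbb{P}(Z^p\le\mathbb{E}Z^p)$ with $Z\sim N(0,1)$.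
   Context: The $p$-spin Curie-Weiss model is the probability measure on $\{-1,1\}^N$ given by $\mathbb{P}_{\beta,h,p}(\boldsymbol\sigma)=\frac{1}{2^NZ_N(\beta,h,p)}\exp\{N(\beta\overline\sigma_N^p+h\overline\sigma_N)\}$, where $\overline\sigma_N=\frac1N\sum_{i=1}^N\sigma_i$ and $Z_N$ is the normalizing constant; expectation is $\mathbb{E}_{\beta,h,p}$. The same formula defines the measure for every real $\beta$. For fixed known $h$, the maximum likelihood estimate $\hat\beta_N\in[-\infty,\infty]$ is the maximizer of the likelihood over all real $\beta$, i.e. the solution in $\beta\in\mathbb{R}$ of $\mathbb{E}_{\beta,h,p}(\overline\sigma_N^p)=\overline\sigma_N^p$; if no real solution exists, it equals $+\infty$ or $-\infty$ according to whether the likelihood is increasing or decreasing in $\beta$. Define $H_{\beta,h,p}:[-1,1]\to\mathbb{R}$ by $H_{\beta,h,p}(x)=\beta x^p+hx-I(x)$, $I(x)=\frac12\{(1+x)\log(1+x)+(1-x)\log(1-x)\}$. The point $(\beta,h)$ is $p$-regular if $H_{\beta,h,p}$ has a unique global maximizer $m_*\in(-1,1)$ and $H_{\beta,h,p}''(m_* )<0$. Define $\tilde\beta_p=\sup\{\beta\ge0:\sup_{x\in[-1,1]}H_{\beta,0,p}(x)=0\}$. $\delta_x$ is the point mass at $x\in[-\infty,\infty]$; weighted sums of distributions denote mixtures; convergence in distribution to a law with mass at $-\infty$ is understood on the extended real line $[-\infty,\infty]$. *)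

(* Defs.v *)
From HB Require Import structures.
From mathcomp Require Import all_boot all_order all_algebra.
From mathcomp Require Import all_classical all_reals all_analysis measurable_realfun.

Set Implicit Arguments.
Unset Strict Implicit.
Unset Printing Implicit Defensive.

Import Order.TTheory GRing.Theory Num.Theory.
Import numFieldNormedType.Exports.

Local Open Scope classical_set_scope.
Local Open Scope ring_scope.

Section curie_weiss.
Context {R : realType}.
Implicit Types (beta h m x : R) (p N : nat).

(* The configuration space {-1,1}^N, with [true] encoding +1 and [false] -1. *)
Definition config N : finType := {ffun 'I_N -> bool}.

Definition spin (b : bool) : R := if b then 1 else -1.

Definition magnetization N (s : config N) : R :=
  N%:R^-1 * \sum_(i < N) spin (s i).

Definition cw_weight beta h p N (s : config N) : R :=
  expR (N%:R * (beta * magnetization s ^+ p + h * magnetization s)).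

Definition cw_partition beta h p N : R :=
  (2 ^+ N)^-1 * \sum_(s : config N) cw_weight beta h p s.

Definition cw_prob beta h p N (s : config N) : R :=
  (2 ^+ N * cw_partition beta h p N)^-1 * cw_weight beta h p s.

Definition mle_real h p N (s : config N) : set R :=
  [set b | forall b', cw_prob b' h p s <= cw_prob b h p s].

(* A maximizer is unique unless the p-th power of the magnetization is
   constant on [config N], which for p > 0 only happens when N = 0, or N = 1
   and p is even; the likelihood is then constant in the parameter and [xget]
   picks an arbitrary real.  When there is no real maximizer the likelihood is
   strictly monotone, so the last case is that of a decreasing likelihood. *)
Definition mle h p N (s : config N) : \bar R :=
  if `[< mle_real h p s !=set0 >] then (xget 0 (mle_real h p s))%:E
  else if `[< {homo (fun b => cw_prob b h p s) : b b' / b < b'} >]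
  then +oo%E else -oo%E.

(* Since [ln 0 = 0] in the library, the endpoint values are
   [cw_entropy 1 = cw_entropy (-1) = ln 2], as with the convention
   0 log 0 = 0. *)
Definition cw_entropy x : R :=
  2^-1 * ((1 + x) * ln (1 + x) + (1 - x) * ln (1 - x)).

Definition cw_H beta h p x : R := beta * x ^+ p + h * x - cw_entropy x.

Definition cw_maximizers beta h p : set R :=
  [set m | m \in `[-1, 1] /\
           forall x, x \in `[-1, 1] -> cw_H beta h p x <= cw_H beta h p m].

Definition p_regular beta h p : Prop :=
  exists m, [/\ cw_maximizers beta h p = [set m],
                m \in `]-1, 1[ & ((cw_H beta h p)^`(2))%classic m < 0].

Definition beta_tilde p : R :=
  sup [set b : R | 0 <= b /\ sup (cw_H b 0 p @` `[-1, 1]) = 0].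

Definition std_normal : probability (measurableTypeR R) R :=
  normal_prob (0 : R) 1.

Definition gamma p : R :=
  fine (std_normal
    [set z : R | (z ^+ p)%:E <= 'E_std_normal[fun z : R => (z ^+ p)%R]]%E).

Lemma gamma_ge0 p : 0 <= gamma p.
Proof. exact/fine_ge0/measure_ge0. Qed.

Lemma gamma_le1 p : gamma p <= 1.
Proof.
rewrite /gamma; set A := [set _ | _].
have mA : measurable A.
  rewrite -[A]setTI; apply: measurable_lee => //.
  by apply/measurable_EFinP/measurable_funX.
rewrite -lee_fin fineK ?probability_le1//.
exact: fin_num_measure.
Qed.

Definition gamma01 p : {i01 R} := Itv01 (gamma_ge0 p) (gamma_le1 p).

Lemma half_ge0 : 0 <= 2^-1 :> R.
Proof. by rewrite invr_ge0. Qed.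

Lemma half_le1 : 2^-1 <= 1 :> R.
Proof. by rewrite invf_le1// ler1n. Qed.

Definition half01 : {i01 R} := Itv01 half_ge0 half_le1.

End curie_weiss.

Section limit_laws.
Context {R : realType}.

(* Weak convergence on the extended real line of the laws of X_N, where X_N is
   defined on a finite probability space with mass function P_N. *)
Definition cvg_in_law (T : nat -> finType) (P : forall N, T N -> R)
    (X : forall N, T N -> \bar R) (mu : {measure set (\bar R) -> \bar R}) : Prop :=
  forall f : \bar R -> R, continuous f -> [bounded f x | x in [set: \bar R]] ->
    (\sum_(s : T N) P N s * f (X N s))%:E @[N --> \oo]
      --> (\int[mu]_x (f x)%:E)%E.

Definition mixture (w : {i01 R}) (mu nu : {measure set (\bar R) -> \bar R}) :
    {measure set (\bar R) -> \bar R} :=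
  measure_add (mscale (w%:num)%:nng mu) (mscale (1 - w%:num)%:nng nu).

HB.instance Definition _ :=
  @isMeasurableFun.Build _ _ (measurableTypeR R) (\bar R) EFin
    (@EFin_measurable R [set: R]).

(* N(0, v), seen on the extended real line; [normal_prob] takes the standard
   deviation as its second argument. *)
Definition normal_law (v : R) : {measure set (\bar R) -> \bar R} :=
  distribution (normal_prob 0 (Num.sqrt v)) (@EFin R).

Definition point_mass (x : \bar R) : {measure set (\bar R) -> \bar R} := \d_x.

End limit_laws.

(* Main.v *)
(* The estimate is a function of the magnetization x alone, namely the minimizer in
   b of the convex function q(b) = E_0 exp(N b (y^p - x^p) + N h (y - x)), where y
   is the magnetization of a uniform configuration.  Laplace's method at the
   maximizer m, in the variable w = sqrt N (y - m), turns all averages into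
   Gaussian integrals.

   If m <> 0, then q(beta + u / sqrt N) is asymptotically proportional to
   exp(u^2 a^2 v / 2 - u a w) with a = p m^(p-1) and v = -1 / H''(m), so
   sqrt N (mle - beta) converges to w / (a v) as a deterministic function of w, and
   w itself is N(0, v) in the limit.

   If m = 0, then between two parameters b < b' for which 0 is still the strict
   maximizer, q(b') - q(b) has the sign of (E Z^p - w^p) once divided by
   N^(1 - p/2), while q blows up beyond the threshold beta_tilde.  Hence the
   estimate goes to beta_tilde if w^p > E Z^p, and otherwise to the other end of
   the subcritical range: - beta_tilde for p odd, - infinity for p even. *)
Require Import Defs.
From mathcomp Require Import all_boot all_order all_algebra.
From mathcomp Require Import all_classical all_reals all_analysis measurable_realfun.
From mathcomp Require Import ring lra.

Import Order.TTheory GRing.Theory Num.Theory.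
Import numFieldNormedType.Exports.

Local Open Scope classical_set_scope.
Local Open Scope ring_scope.

(** Convexity of q is what makes pointwise limits sufficient: one strict inequality between the
    values of q at two parameters bounds the estimate from one side, so no control uniform in the
    parameter enters, and infinite estimates are covered as well. The obstacle is that q itself
    depends on the observed magnetization, which moves with N. Every limit is therefore taken along
    an arbitrary sequence m + z N / sqrt N with z converging to w. This form of convergence composes
    with Laplace's method: it is used on q, with the observation frozen along such a sequence, and a
    second time on the expectation of a test function of the estimate, where the limits just found
    are the pointwise hypothesis. It takes the place of a continuous mapping theorem. Only almost
    every w counts, which disposes of the tie w^p = E Z^p when m = 0. In that case q has the same
    limit at any two subcritical parameters, so a difference quotient of the integrand, rather than
    q, goes through Laplace's method; p >= 3 makes its scale vanish. *)

Section pointwise_derivatives.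
Context {R : realType}.
Implicit Types (f g : R -> R) (x : R).

Lemma is_derive_addf f g x (a b : R) : is_derive x 1 f a -> is_derive x 1 g b ->
  is_derive x 1 (fun y => f y + g y) (a + b).
Proof. exact: is_deriveD. Qed.

Lemma is_derive_oppf f x (a : R) : is_derive x 1 f a ->
  is_derive x 1 (fun y => - f y) (- a).
Proof. exact: is_deriveN. Qed.

Lemma is_derive_mulf f g x (a b : R) : is_derive x 1 f a -> is_derive x 1 g b ->
  is_derive x 1 (fun y => f y * g y) (a * g x + f x * b).
Proof.
move=> fa gb; apply: is_derive_eq (is_deriveM fa gb) _.
by rewrite /GRing.scale/= addrC mulrC.
Qed.

Lemma is_derive_invf f x (a : R) : f x != 0 -> is_derive x 1 f a ->
  is_derive x 1 (fun y => (f y)^-1) (- a / f x ^+ 2).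
Proof.
move=> fx fa; apply: is_derive_eq (is_deriveV fx fa) _.
by rewrite /GRing.scale/= mulNr mulrC mulNr.
Qed.

Lemma is_derive_lnf f x (a : R) : 0 < f x -> is_derive x 1 f a ->
  is_derive x 1 (fun y => ln (f y)) (a / f x).
Proof.
move=> fx fa; have lnx : is_derive (f x) 1 (@ln R) (f x)^-1.
  exact: is_derive1_ln.
by apply: is_derive_eq (is_derive1_comp lnx fa) _; rewrite mulrC.
Qed.

Lemma is_derive_expf n x : is_derive x 1 (fun y => y ^+ n) (n%:R * x ^+ n.-1).
Proof.
have h := is_deriveX n (is_derive_id x (1 : R)).
have -> : (fun y : R => y ^+ n) = id ^+ n by apply/funext => y; rewrite fctE.
by move: h; rewrite /GRing.scale/= mulr1.
Qed.

Lemma is_derive_cstf (c : R) x : is_derive x 1 (fun=> c) 0.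
Proof. exact: is_derive_cst. Qed.

Lemma is_derive_idf x : is_derive x 1 (fun y => y) 1.
Proof. exact: is_derive_id. Qed.

Lemma is_derive_eqf f x (a b : R) : is_derive x 1 f a -> a = b ->
  is_derive x 1 f b.
Proof. by move=> ? <-. Qed.

End pointwise_derivatives.

(* [is_derive] is a type class: a plain [apply] would let resolution choose the
   derivatives, in a form which [field] does not accept. *)
Ltac derivef := repeat (
  lazymatch goal with |- is_derive ?x ?v ?f ?d =>
    let g := eval cbv beta in (fun y => f y) in change (is_derive x v g d) end;
  lazymatch goal with
  | |- is_derive _ _ (fun y => _ + _) _ => notypeclasses refine (is_derive_addf _ _ _ _ _ _ _)
  | |- is_derive _ _ (fun y => - _) _ => notypeclasses refine (is_derive_oppf _ _ _ _)
  | |- is_derive _ _ (fun y => _ * _) _ => notypeclasses refine (is_derive_mulf _ _ _ _ _ _ _)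
  | |- is_derive _ _ (fun y => _^-1) _ => notypeclasses refine (is_derive_invf _ _ _ _ _)
  | |- is_derive _ _ (fun y => ln _) _ => notypeclasses refine (is_derive_lnf _ _ _ _ _)
  | |- is_derive _ _ (fun y => y ^+ _) _ => notypeclasses refine (is_derive_expf _ _)
  | |- is_derive _ _ (fun y => y) _ => notypeclasses refine (is_derive_idf _)
  | |- is_derive _ _ (fun y => ?c) _ => notypeclasses refine (is_derive_cstf _ _)
  end).

Lemma ge0_of_derive (R : realType) (f df : R -> R) (b : R) :
  (forall x, 0 <= x <= b -> is_derive x 1 f (df x)) ->
  (forall x, 0 <= x <= b -> 0 <= df x) -> 0 <= f 0 -> 0 <= b -> 0 <= f b.
Proof.
move=> fdf df0 f0 b0.
have [||c + E] := @MVT_segment R f df 0 b b0.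
- by move=> x /[!in_itv]/= /andP[x0 xb]; apply: fdf; rewrite !ltW.
- apply/derivable_within_continuous => x /[!in_itv]/= xb.
  by have := fdf _ xb => - [].
- rewrite in_itv/= => cb; move: E => /eqP; rewrite subr_eq subr0 => /eqP ->.
  by rewrite addr_ge0// mulr_ge0// df0.
Qed.

(** The midpoint rule underestimates the integral of the convex function 1 / (1 + s) over [0, t]. At
    t = 1/n the bound is 1 / (n + 1/2), exactly what makes [ln_stirling] nonincreasing. *)
Lemma ln1D_ge (R : realType) (t : R) : 0 <= t -> 2 * t / (2 + t) <= ln (1 + t).
Proof.
move=> t0; rewrite -subr_ge0.
pose f (x : R) := ln (1 + x) - 2 * x / (2 + x).
apply: (@ge0_of_derive R f
   (fun x => x ^+ 2 / ((1 + x) * (2 + x) ^+ 2)) t) => //; last first.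
- by rewrite /f addr0 ln1 mulr0 mul0r subr0.
- move=> x /andP[x0 _]; rewrite divr_ge0 ?sqr_ge0// mulr_ge0 ?sqr_ge0//; lra.
move=> x /andP[x0 _].
have x1 : 0 < 1 + x by lra.
have x2 : 0 < 2 + x by lra.
apply: is_derive_eq; first by rewrite /f; derivef => //; rewrite gt_eqF.
by rewrite /=; field; rewrite !gt_eqF.
Qed.

(** The trapezoidal rule for the same integral, which overestimates it. *)
Lemma ln1D_le (R : realType) (t : R) : 0 <= t ->
  ln (1 + t) <= t * (2 + t) / (2 * (1 + t)).
Proof.
move=> t0; rewrite -subr_ge0.
pose f (x : R) := x * (2 + x) / (2 * (1 + x)) - ln (1 + x).
apply: (@ge0_of_derive R f (fun x => x ^+ 2 / (2 * (1 + x) ^+ 2)) t) => //;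
  last first.
- by rewrite /f !addr0 ln1 !mul0r subr0.
- by move=> x /andP[x0 _]; rewrite divr_ge0 ?sqr_ge0// mulr_ge0 ?sqr_ge0.
move=> x /andP[x0 _].
have x1 : 0 < 1 + x by lra.
apply: is_derive_eq; first by rewrite /f; derivef => //; rewrite gt_eqF// mulr_gt0.
by rewrite /=; field; rewrite !gt_eqF.
Qed.

(** * Stirling's formula up to a constant *)

Section stirling.
Context {R : realType}.
Implicit Types n k j : nat.

(* The logarithm of [n! e^n / (n^n sqrt n)].  It decreases to a limit whose value
   ([ln (2 pi) / 2]) is never needed, because only ratios of averages occur. *)
Definition ln_stirling n : R := ln (n`!%:R) + n%:R - (n%:R + 2^-1) * ln n%:R.

Lemma ln_stirlingB n : (0 < n)%N ->
  ln_stirling n - ln_stirling n.+1 = (n%:R + 2^-1) * ln (1 + n%:R^-1) - 1.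
Proof.
move=> n0; have n0' : 0 < n%:R :> R by rewrite ltr0n.
have -> : 1 + n%:R^-1 = n.+1%:R / n%:R :> R.
  by rewrite -natr1 mulrDl mul1r divff ?gt_eqF.
rewrite ln_div ?posrE ?ltr0n// /ln_stirling factS natrM lnM ?posrE ?ltr0n ?fact_gt0//.
by rewrite -natr1; ring.
Qed.

Lemma ln_stirling_nincr n : (0 < n)%N -> ln_stirling n.+1 <= ln_stirling n.
Proof.
move=> n0; rewrite -subr_ge0 ln_stirlingB// subr_ge0.
have n0' : 0 < n%:R :> R by rewrite ltr0n.
have := @ln1D_ge R n%:R^-1; rewrite invr_ge0 ltW// => /(_ isT).
have -> : 2 * n%:R^-1 / (2 + n%:R^-1) = (n%:R + 2^-1)^-1 :> R.
  by field; rewrite !gt_eqF//; lra.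
rewrite -[X in X <= _]mul1r ler_pdivrMr; last lra.
by rewrite mulrC.
Qed.

(** At t = 1/n the trapezoidal bound limits the decrement to 1 / (4 n (n + 1)), which telescopes.
    Starting from 1 - 1/4 at n = 1, this bounds [ln_stirling] from below. *)
Lemma ln_stirling_ndecr n : (0 < n)%N ->
  ln_stirling n - (4 * n%:R)^-1 <= ln_stirling n.+1 - (4 * n.+1%:R)^-1.
Proof.
move=> n0; have n0' : 0 < n%:R :> R by rewrite ltr0n.
have swap (a b c d : R) : a - b <= c - d -> a - c <= b - d by lra.
apply: swap.
rewrite ln_stirlingB//.
have := @ln1D_le R n%:R^-1; rewrite invr_ge0 ltW// => /(_ isT) h.
apply: (@le_trans _ _ ((n%:R + 2^-1) *
    (n%:R^-1 * (2 + n%:R^-1) / (2 * (1 + n%:R^-1))) - 1)).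
  by rewrite lerD2r ler_wpM2l// addr_ge0// ltW.
rewrite -natr1 le_eqVlt; apply/orP; left; apply/eqP; field.
by rewrite !gt_eqF//; lra.
Qed.

Lemma ln_stirling1 : ln_stirling 1 = 1.
Proof. by rewrite /ln_stirling (factS 0) fact0 muln1 ln1 mulr0 subr0 add0r. Qed.

Lemma ln_stirling_le1 n : (0 < n)%N -> ln_stirling n <= 1.
Proof.
case: n => // n _; elim: n => [|n]; first by rewrite ln_stirling1.
exact/le_trans/ln_stirling_nincr.
Qed.

Lemma ln_stirling_ge0 n : (0 < n)%N -> 0 <= ln_stirling n.
Proof.
move=> n0; suff : 3 / 4 <= ln_stirling n - (4 * n%:R)^-1.
  by move=> h; rewrite (le_trans _ (le_trans h _))// gerBl invr_ge0.
case: n n0 => // n _; elim: n => [|n IH].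
  by rewrite ln_stirling1; lra.
by apply: (le_trans IH); exact: ln_stirling_ndecr.
Qed.

Lemma is_cvg_ln_stirling : cvgn ln_stirling.
Proof.
suff /cvg_ex[l] : cvgn [sequence ln_stirling n.+1]_n.
  by rewrite (cvg_shiftS ln_stirling) => ul; apply/cvg_ex; exists l.
apply: nonincreasing_is_cvgn.
  by apply/nonincreasing_seqP => n; exact: ln_stirling_nincr.
by exists 0 => _ [n _ <-]; exact: ln_stirling_ge0.
Qed.

End stirling.

(** * Averages over configurations *)

Section configurations.
Context {R : realType}.
Implicit Types (N k j : nat) (x : R).

Definition config_avg N (F : R -> R) : R :=
  (2 ^+ N)^-1 * \sum_(s : config N) F (magnetization s).

Lemma spinE (b : bool) : spin b = 2 * b%:R - 1 :> R.
Proof. by case: b; rewrite /spin/= ?mulr1 ?mulr0 ?sub0r//; ring. Qed.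

Lemma magnetizationE N (s : config N) :
  magnetization s = N%:R^-1 * (2 * #|[set i | s i]%SET|%:R - N%:R) :> R.
Proof.
rewrite /magnetization; congr (_ * _).
under eq_bigr do rewrite spinE.
rewrite sumrB -mulr_sumr sumr_const card_ord; congr (2 * _ - _).
by rewrite -sum1dep_card natr_sum [RHS]big_mkcond/=; apply: eq_bigr => i _; case: (s i).
Qed.

Lemma magnetization_itv N (s : config N) :
  -1 <= (magnetization s : R) <= 1.
Proof.
have [N0|N0] := posnP N.
  by move: s; rewrite N0 => s; rewrite /magnetization invr0 mul0r; apply/andP; split; lra.
have N0' : 0 < N%:R :> R by rewrite ltr0n.
rewrite magnetizationE mulrC ler_pdivlMr// ler_pdivrMr//.
have : (#|[set i | s i]%SET| <= N)%N by rewrite -[leqRHS]card_ord max_card.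
rewrite -(ler_nat R); have : 0 <= #|[set i | s i]%SET|%:R :> R by [].
by move=> ? ?; apply/andP; split; lra.
Qed.

Lemma card_config_count N k :
  #|[set s : config N | #|[set i | s i]%SET| == k]%SET| = 'C(N, k).
Proof.
rewrite -[N in RHS]card_ord -card_draws.
rewrite -(card_imset _ (f := fun s : config N => [set i | s i]%SET)).
  congr #|pred_of_set _|; apply/setP => A; rewrite inE.
  apply/imsetP/idP => [[s /[!inE] sk ->]//|Ak].
  exists [ffun i => i \in A]; rewrite ?inE; last first.
    by apply/setP => i; rewrite inE ffunE.
  by rewrite (_ : finset _ = A)//; apply/setP => i; rewrite inE ffunE.
move=> s t /setP st; apply/ffunP => i; have := st i.
by rewrite !inE.
Qed.

Lemma config_avg_binomial N (F : R -> R) :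
  config_avg N F = \sum_(k < N.+1)
     'C(N, k)%:R / 2 ^+ N * F (N%:R^-1 * (2 * k%:R - N%:R)).
Proof.
rewrite /config_avg mulr_sumr.
have lt s : (#|[set i | (s : config N) i]%SET| < N.+1)%N.
  by rewrite ltnS -[leqRHS]card_ord max_card.
rewrite (partition_big (fun s => Ordinal (lt s)) xpredT)//=.
apply: eq_bigr => k _.
rewrite (eq_bigr (fun=> (2 ^+ N)^-1 * F (N%:R^-1 * (2 * k%:R - N%:R)))); last first.
  by move=> s /eqP <-; rewrite magnetizationE.
rewrite -mulrA -card_config_count -sum1dep_card natr_sum mulr_suml.
apply: eq_big => [s|s _]; last by rewrite mul1r.
by rewrite -val_eqE.
Qed.

(** The numbers k and j of plus and minus spins replace N and k, which avoids truncated subtraction.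
    Either may be 0: the factor in front then annihilates the logarithm. *)
Lemma cw_entropy_lattice k j : (0 < k + j)%N ->
  (k + j)%:R * cw_entropy ((k + j)%:R^-1 * (2 * k%:R - (k + j)%:R)) =
  k%:R * ln k%:R + j%:R * ln j%:R - (k + j)%:R * ln (k + j)%:R
    + (k + j)%:R * ln 2 :> R.
Proof.
move=> kj; have kj0 : 0 < (k + j)%:R :> R by rewrite ltr0n.
have e1 : 1 + (k + j)%:R^-1 * (2 * k%:R - (k + j)%:R) = k%:R * (2 / (k + j)%:R) :> R.
  by rewrite natrD; field; rewrite -natrD gt_eqF.
have e2 : 1 - (k + j)%:R^-1 * (2 * k%:R - (k + j)%:R) = j%:R * (2 / (k + j)%:R) :> R.
  by rewrite natrD; field; rewrite -natrD gt_eqF.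
have lnm i : i%:R * ln (i%:R * (2 / (k + j)%:R)) =
    i%:R * ln i%:R + i%:R * (ln 2 - ln (k + j)%:R) :> R.
  have [->|i0] := posnP i; first by rewrite !mul0r addr0.
  by rewrite lnM ?posrE ?ltr0n ?divr_gt0// ln_div ?posrE// mulrDr.
rewrite /cw_entropy e1 e2.
transitivity (k%:R * ln (k%:R * (2 / (k + j)%:R)) +
   j%:R * ln (j%:R * (2 / (k + j)%:R)) : R).
  by rewrite natrD; field; rewrite -natrD gt_eqF.
by rewrite !lnm natrD; ring.
Qed.

(* [(k + j) choose k] over [2 ^ (k + j)] without its exponential rate. *)
Definition binomial_peak k j : R := 'C(k + j, k)%:R / 2 ^+ (k + j) *
  expR ((k + j)%:R * cw_entropy ((k + j)%:R^-1 * (2 * k%:R - (k + j)%:R))).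

(** An identity, since [ln_stirling] is the exact remainder of each of the three factorials: the
    terms n ln n cancel against the entropy, and the square root collects the half-integer
    powers. *)
Lemma binomial_peakE k j : (0 < k)%N -> (0 < j)%N ->
  binomial_peak k j = expR (ln_stirling (k + j) - ln_stirling k - ln_stirling j)
    * Num.sqrt ((k + j)%:R / (k%:R * j%:R)).
Proof.
move=> k0 j0; have kj0 : (0 < k + j)%N by rewrite addn_gt0 k0.
have [K0 J0 KJ0] : [/\ 0 < k%:R :> R, 0 < j%:R :> R & 0 < (k + j)%:R :> R].
  by rewrite !ltr0n.
have s0 : 0 < (k + j)%:R / (k%:R * j%:R) :> R by rewrite divr_gt0// mulr_gt0.
apply: ln_inj; rewrite ?posrE.
- by rewrite /binomial_peak mulr_gt0 ?expR_gt0// divr_gt0 ?exprn_gt0// ltr0n bin_gt0 leq_addr.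
- by rewrite mulr_gt0 ?expR_gt0// sqrtr_gt0.
rewrite /binomial_peak cw_entropy_lattice//.
have -> : 'C(k + j, k)%:R = (k + j)`!%:R / (k`!%:R * j`!%:R) :> R.
  apply: (@mulIf _ (k`!%:R * j`!%:R)).
    by rewrite mulf_neq0// pnatr_eq0 -lt0n fact_gt0.
  rewrite divfK ?mulf_neq0 ?pnatr_eq0 -?lt0n ?fact_gt0//.
  by rewrite -!natrM -(bin_fact (leq_addr j k)) addKn.
rewrite -powR12_sqrt ?(ltW s0)//.
rewrite !(lnM, lnV) ?posrE ?(expR_gt0, powR_gt0, invr_gt0, divr_gt0, mulr_gt0,
  exprn_gt0, ltr0n, fact_gt0, addn_gt0, k0)//.
rewrite !expRK ln_powR !(lnM, lnV) ?posrE ?(expR_gt0, powR_gt0, invr_gt0,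
  divr_gt0, mulr_gt0, exprn_gt0, ltr0n, fact_gt0, addn_gt0, k0)//.
rewrite lnXn// /ln_stirling -mulr_natl !natrD.
by field.
Qed.

Lemma binomial_peak_ge0 k j : 0 <= binomial_peak k j.
Proof. by rewrite mulr_ge0 ?expR_ge0// divr_ge0 ?exprn_ge0. Qed.

(* A single term of the binomial expansion of [(k + j) ^ (k + j)]. *)
Lemma binomial_peak_le1 k j : (0 < k + j)%N -> binomial_peak k j <= 1.
Proof.
move=> kj; have KJ0 : 0 < (k + j)%:R :> R by rewrite ltr0n.
have xx i : expR (i%:R * ln i%:R) = i%:R ^+ i :> R.
  have [->|i0] := posnP i; first by rewrite mul0r expR0 expr0.
  by rewrite expRM_natl lnK// posrE ltr0n.
rewrite /binomial_peak cw_entropy_lattice// expRD expRB expRD !xx.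
rewrite expRM_natl lnK ?posrE//.
have E (a b c d e : R) : c != 0 -> d != 0 ->
  a / c * (b * e / d * c) = a * (b * e) / d by move=> *; field; apply/andP.
rewrite E ?expf_neq0 ?gt_eqF//.
rewrite ler_pdivrMr ?exprn_gt0// mul1r.
rewrite -!natrX -!natrM ler_nat [in leqRHS](addnC k j) expnDn.
rewrite (bigD1 (inord k))//= inordK ?ltnS ?leq_addl// addnK (mulnC (j ^ j)%N).
by rewrite [in 'C(_, _)]addnC leq_addr.
Qed.

End configurations.

(** * Binomial weights on the lattice of magnetizations *)

Section lattice_asymptotics.
Context {R : realType}.
Implicit Types (N k j : nat) (m c : R).

Definition lattice_pt N k : R := N%:R^-1 * (2 * k%:R - N%:R).

Lemma lattice_pt_itv N k : (0 < N)%N -> (k <= N)%N -> -1 <= lattice_pt N k <= 1.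
Proof.
move=> N0 kN; have N0' : 0 < N%:R :> R by rewrite ltr0n.
rewrite /lattice_pt mulrC ler_pdivlMr// ler_pdivrMr//.
move: kN; rewrite -(ler_nat R); have : 0 <= k%:R :> R by [].
by move=> ? ?; apply/andP; split; lra.
Qed.

Lemma lattice_pt1D N k : (0 < N)%N -> k%:R = N%:R * (1 + lattice_pt N k) / 2.
Proof.
move=> N0; have N0' : 0 < N%:R :> R by rewrite ltr0n.
by rewrite /lattice_pt; field; rewrite gt_eqF.
Qed.

Lemma lattice_pt1B N k : (0 < N)%N -> (k <= N)%N ->
  (N - k)%:R = N%:R * (1 - lattice_pt N k) / 2.
Proof.
move=> N0 kN; have N0' : 0 < N%:R :> R by rewrite ltr0n.
by rewrite natrB// /lattice_pt; field; rewrite gt_eqF.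
Qed.

Lemma binomial_peak_lattice N k : (0 < k < N)%N ->
  Num.sqrt N%:R * binomial_peak k (N - k) =
  expR (ln_stirling N - ln_stirling k - ln_stirling (N - k)) *
  Num.sqrt (4 / ((1 + lattice_pt N k) * (1 - lattice_pt N k))).
Proof.
move=> /andP[k0 kN]; have N0 : (0 < N)%N by exact: leq_trans kN.
have N0' : 0 < N%:R :> R by rewrite ltr0n.
rewrite binomial_peakE ?subn_gt0// subnKC ?(ltnW kN)// mulrCA; congr (_ * _).
rewrite -sqrtrM ?ler0n//; congr Num.sqrt.
rewrite lattice_pt1B ?(ltnW kN)// (lattice_pt1D N k N0).
have : 0 < k%:R :> R by rewrite ltr0n.
have : 0 < (N - k)%:R :> R by rewrite ltr0n subn_gt0.
rewrite lattice_pt1B ?(ltnW kN)// (lattice_pt1D N k N0).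
have pos (y : R) : 0 < N%:R * y / 2 -> 0 < y.
  by move=> h; rewrite -(pmulr_rgt0 _ N0') -(@pmulr_lgt0 _ 2^-1)// invr_gt0.
move=> /pos x1 /pos x2.
by field; rewrite !gt_eqF.
Qed.

(** Near m the rescaled peak is bounded. Close to -1 and 1 it may be as large as sqrt N, but there
    the Gaussian factor is exponentially large in N. As c is arbitrary, this growth can be charged
    to a fraction of any quadratic gap. *)
Lemma binomial_peak_bound m c : -1 < m < 1 -> 0 < c -> exists2 K : R, 0 < K &
  forall N k, (0 < N)%N -> (k <= N)%N ->
  Num.sqrt N%:R * binomial_peak k (N - k) <=
    K * expR (c * N%:R * (lattice_pt N k - m) ^+ 2).
Proof.
(* A point within d of m stays at distance at least d from -1 and from 1. *)
move=> m1 c0; pose d : R := (1 - `|m|) / 2.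
have m1' : `|m| < 1 by rewrite ltr_norml.
have d0 : 0 < d by rewrite divr_gt0// subr_gt0.
have a0 : 0 < c * d ^+ 2 by rewrite mulr_gt0// exprn_gt0.
(* The first summand serves the points within d of m: e bounds the Stirling corrections and 2 / d
   the square root. The second serves the others, through N a <= exp (N a) with a = c d^2. *)
exists (expR 1 * (2 / d) + (c * d ^+ 2)^-1).
  by rewrite addr_gt0 ?invr_gt0// mulr_gt0 ?expR_gt0// divr_gt0.
move=> N k N0 kN; have N0' : 0 < N%:R :> R by rewrite ltr0n.
have [dx|dx] := ltP (`|lattice_pt N k - m|) d; last first.
  apply: (@le_trans _ _ N%:R).
    rewrite -[leRHS]mulr1; apply: ler_pM; rewrite ?sqrtr_ge0 ?binomial_peak_ge0//.
      rewrite -[leRHS]ger0_norm// -sqrtr_sqr ler_sqrt ?sqr_ge0//.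
      by rewrite expr2 ler_peMl// ler1n.
    by rewrite binomial_peak_le1// subnKC.
  rewrite mulrDl -[leLHS]add0r lerD//.
    by rewrite !mulr_ge0 ?expR_ge0// ?invr_ge0 ltW.
  rewrite mulrC ler_pdivlMr//.
  apply: (@le_trans _ _ (expR (N%:R * (c * d ^+ 2)))).
    by rewrite (le_trans _ (expR_ge1Dx _))// lerDr.
  rewrite ler_expR mulrCA mulrA ler_wpM2l ?mulr_ge0 ?(ltW c0)//.
  rewrite -[leRHS]real_normK ?num_real//.
  by rewrite ler_pXn2r ?nnegrE// ltW.
have [x1 x2] : d <= 1 + lattice_pt N k /\ d <= 1 - lattice_pt N k.
  have : - `|m| <= m by rewrite lerNl -normrN ler_norm.
  have := ler_norm m; move: dx; rewrite ltr_norml /d => /andP[? ?] ? ?.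
  by split; lra.
have k0 : (0 < k)%N.
  by rewrite -(ltr0n R) (lattice_pt1D N k N0) divr_gt0// mulr_gt0// (lt_le_trans d0).
have j0 : (k < N)%N.
  rewrite -subn_gt0 -(ltr0n R) (lattice_pt1B N k N0 kN) divr_gt0// mulr_gt0//.
  exact: lt_le_trans x2.
rewrite binomial_peak_lattice ?k0//.
apply: (@le_trans _ _ (expR 1 * (2 / d))); last first.
  rewrite -[leLHS]mulr1; apply: ler_pM => //.
  - by rewrite mulr_ge0 ?expR_ge0// divr_ge0// ltW.
  - by rewrite lerDl invr_ge0 ltW.
  - by rewrite -expR0 ler_expR mulr_ge0 ?sqr_ge0// mulr_ge0// ltW.
apply: ler_pM; rewrite ?expR_ge0 ?sqrtr_ge0//.
  rewrite ler_expR; have := @ln_stirling_le1 R N N0.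
  have := @ln_stirling_ge0 R k k0; have := @ln_stirling_ge0 R (N - k)%N.
  by rewrite subn_gt0 => /(_ j0); lra.
have xd : 0 < 2 / d by rewrite divr_gt0.
rewrite -[leRHS]ger0_norm ?(ltW xd)// -sqrtr_sqr ler_sqrt ?sqr_ge0//.
rewrite expr_div_n -natrX ler_pM2l// lef_pV2 ?posrE ?exprn_gt0//.
  by rewrite expr2 ler_pM// ltW.
by rewrite mulr_gt0// (lt_le_trans d0).
Qed.

Lemma cvgn_to_infty (u : nat -> nat) (a : R) : 0 < a ->
  (\forall N \near \oo, N%:R * a <= (u N)%:R) -> u N @[N --> \oo] --> \oo.
Proof.
move=> a0 ua; apply/cvgnyPge => A; near=> N.
rewrite -(ler_nat R) (le_trans _ (near ua N _))// -ler_pdivrMr//.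
by near: N; exact: nbhs_infty_ger.
Unshelve. all: by end_near. Qed.

(** The indices N, k N and N - k N all tend to infinity because m is interior, so the three Stirling
    corrections have the same limit L and combine to L - L - L = - L. *)
Lemma cvg_binomial_peak m (k : nat -> nat) : -1 < m < 1 ->
  (\forall N \near \oo, (k N <= N)%N) ->
  lattice_pt N (k N) @[N --> \oo] --> m ->
  Num.sqrt N%:R * binomial_peak (k N) (N - k N) @[N --> \oo] -->
  expR (- limn (@ln_stirling R)) * Num.sqrt (4 / ((1 + m) * (1 - m))).
Proof.
move=> /andP[m1 m2] kN xm; set L := limn _.
have Lc : @ln_stirling R n @[n --> \oo] --> L by exact: is_cvg_ln_stirling.
have h1 : \forall N \near \oo, (1 + m) / 2 <= 1 + lattice_pt N (k N).
  have : (m - 1) / 2 < m by lra.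
  by move/(cvgr_ge _ xm); apply: filterS => N; lra.
have h2 : \forall N \near \oo, (1 - m) / 2 <= 1 - lattice_pt N (k N).
  have : m < (m + 1) / 2 by lra.
  by move/(cvgr_le _ xm); apply: filterS => N; lra.
have kk : k N @[N --> \oo] --> \oo.
  apply: (cvgn_to_infty _ ((1 + m) / 4)); first lra.
  near=> N; rewrite (lattice_pt1D N (k N)); last by near: N; exact: nbhs_infty_gt.
  rewrite -[leRHS]mulrA ler_wpM2l//.
  have : (1 + m) / 2 <= 1 + lattice_pt N (k N) by near: N.
  lra.
have jj : (N - k N)%N @[N --> \oo] --> \oo.
  apply: (cvgn_to_infty _ ((1 - m) / 4)); first lra.
  near=> N; rewrite (lattice_pt1B N (k N)); last 2 first.
  - by near: N; exact: nbhs_infty_gt.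
  - by near: N.
  rewrite -[leRHS]mulrA ler_wpM2l//.
  have : (1 - m) / 2 <= 1 - lattice_pt N (k N) by near: N.
  lra.
have : expR (ln_stirling N - ln_stirling (k N) - ln_stirling (N - k N)%N) *
  Num.sqrt (4 / ((1 + lattice_pt N (k N)) * (1 - lattice_pt N (k N)))) @[N --> \oo]
   --> expR (- L) * Num.sqrt (4 / ((1 + m) * (1 - m))).
  apply: cvgM.
    apply: continuous_cvg; first exact: continuous_expR.
    rewrite -[X in _ --> X]add0r -[in X in _ --> X](subrr L).
    apply: cvgB; first apply: cvgB => //.
    - exact: (cvg_comp _ _ kk Lc).
    - exact: (cvg_comp _ _ jj Lc).
  apply: continuous_cvg; first exact: sqrt_continuous.
  apply: cvgM; first exact: cvg_cst.
  apply: cvgV; first by rewrite gt_eqF// mulr_gt0//; lra.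
  by apply: cvgM; [apply: cvgD|apply: cvgB] => //; exact: cvg_cst.
apply: cvg_trans; apply: near_eq_cvg; near=> N.
rewrite binomial_peak_lattice//; apply/andP; split.
  by near: N; move/cvgnyPgt : kk; exact.
by rewrite -subn_gt0; near: N; move/cvgnyPgt : jj; exact.
Unshelve. all: by end_near. Qed.

End lattice_asymptotics.

(** * Gaussian integrals and step functions *)

Section gaussian_integrals.
Context {R : realType}.
Notation mu := (@lebesgue_measure R).
Implicit Types (v b : R).

(** Completing the square: a Gaussian weight of variance v tilted by b w is a multiple of the normal
    density with mean b v. *)
Lemma normal_pdf_expR v b (w : R) : 0 < v ->
  expR (- (w ^+ 2 / (2 * v)) + b * w) =
  Num.sqrt (v * pi *+ 2) * expR (b ^+ 2 * v / 2) * normal_pdf (b * v) (Num.sqrt v) w.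
Proof.
move=> v0; rewrite normal_pdfE ?gt_eqF ?sqrtr_gt0// /normal_peak /normal_fun.
rewrite sqr_sqrtr ?(ltW v0)// mulrACA divff; last first.
  by rewrite gt_eqF// sqrtr_gt0 pmulrn_lgt0// mulr_gt0// pi_gt0.
rewrite mul1r -expRD; congr expR; rewrite -mulr_natr; field.
by rewrite gt_eqF.
Qed.

Lemma integrable_gauss_tilt v b : 0 < v ->
  mu.-integrable setT (fun w => (expR (- (w ^+ 2 / (2 * v)) + b * w))%:E).
Proof.
move=> v0; under eq_fun do rewrite normal_pdf_expR// EFinM.
exact/integrableZl/integrable_normal_pdf.
Qed.

Lemma Rintegral_gauss_tilt v b : 0 < v ->
  \int[mu]_w expR (- (w ^+ 2 / (2 * v)) + b * w) =
  Num.sqrt (v * pi *+ 2) * expR (b ^+ 2 * v / 2).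
Proof.
move=> v0; rewrite /Rintegral.
under eq_integral do rewrite normal_pdf_expR// EFinM.
rewrite integralZl//=; last exact: integrable_normal_pdf.
by rewrite integral_normal_pdf mule1.
Qed.

End gaussian_integrals.

Section step_functions.
Context {R : realType}.
Notation mu := (@lebesgue_measure R).
Implicit Types (n : nat) (g a : nat -> R).

Definition step_fun n g a (w : R) : R :=
  \sum_(k < n) a k * \1_(`[g k, g k.+1[%classic) w.

Lemma measurable_step_fun n g a : measurable_fun setT (step_fun n g a).
Proof.
apply: measurable_sum => i; apply: measurable_funM => //.
Qed.

Lemma integral_step_fun n g a : (forall k, g k <= g k.+1) ->
  (\int[mu]_w (step_fun n g a w)%:E =
  (\sum_(k < n) a k * (g k.+1 - g k))%:E)%E.
Proof.
move=> gS; rewrite /step_fun.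
under eq_integral do rewrite -sumEFin.
rewrite integral_sum//=; last first.
  move=> k; under eq_fun do rewrite EFinM.
  by apply: integrableZl => //; exact: integrable_indic_itv.
rewrite -sumEFin; apply: eq_bigr => k _.
under eq_integral do rewrite EFinM.
rewrite integralZl//=; last exact: integrable_indic_itv.
rewrite integral_indic//= setIT lebesgue_measure_itv/= lte_fin.
have := gS k; rewrite le_eqVlt => /predU1P[->|->]; last by rewrite -EFinB.
by rewrite ltxx mule0 subrr mulr0.
Qed.

Lemma step_fun_cell n g a i w : (forall k, g k <= g k.+1) -> (i < n)%N ->
  g i <= w < g i.+1 -> step_fun n g a w = a i.
Proof.
move=> gS lin /andP[iw wi]; rewrite /step_fun (bigD1 (Ordinal lin))//= big1 ?addr0.
  by rewrite indicE mem_set ?mulr1//= in_itv/= iw wi.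
have gm : {homo g : k j / (k <= j)%N >-> k <= j} by apply: homo_leq => //; exact: le_trans.
move=> k; rewrite -val_eqE/= => ki; rewrite indicE memNset ?mulr0//= in_itv/=.
move=> /andP[kw wk]; case: (ltngtP k i) ki => // [/gm|/gm] + _.
- by move/(lt_le_trans wk); rewrite ltNge iw.
- by move/(lt_le_trans wi); rewrite ltNge kw.
Qed.

Lemma step_fun_bound n g a w (M : R) : (forall k, g k <= g k.+1) -> 0 <= M ->
  (forall k, (k < n)%N -> g k <= w < g k.+1 -> `|a k| <= M) ->
  `|step_fun n g a w| <= M.
Proof.
move=> gS M0 aM; have [/existsP[i iw]|] :=
  boolP [exists i : 'I_n, g i <= w < g i.+1].
  by rewrite (@step_fun_cell _ _ _ i)// aM.
rewrite negb_exists => /forallP Nw; rewrite /step_fun big1 ?normr0// => k _.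
by rewrite indicE memNset ?mulr0//= in_itv/=; exact/negP.
Qed.

End step_functions.

(** * Laplace's method *)

Section laplace.
Context {R : realType}.
Notation mu := (@lebesgue_measure R).

(* The average is the integral of a step function in [w = sqrt N (x - m)], with
   steps at the lattice points, and dominated convergence applies.  The pointwise
   hypothesis is on sequences because the lattice point next to [w] moves with N. *)
Theorem laplace_config_avg (m : R) : -1 < m < 1 -> exists2 kappa : R, 0 < kappa &
  forall (Phi : nat -> R -> R) (Psi : R -> R) (C c : R), 0 < c ->
  (forall N (x : R), (0 < N)%N -> -1 <= x <= 1 ->
    `|Phi N x| <= C * expR (N%:R * cw_entropy x - c * N%:R * (x - m) ^+ 2)) ->
  measurable_fun setT Psi ->
  {ae mu, forall w, forall z : nat -> R, z @ \oo --> w ->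
    Phi N (m + z N / Num.sqrt N%:R) *
      expR (- (N%:R * cw_entropy (m + z N / Num.sqrt N%:R))) @[N --> \oo] --> Psi w} ->
  mu.-integrable setT (EFin \o Psi) /\
  config_avg N (Phi N) @[N --> \oo] --> kappa * \int[mu]_w Psi w.
Proof.
(* The limit of the rescaled peak, halved because neighbouring lattice points are 2 / sqrt N apart
   in the variable w. *)
move=> m1; pose kappa := expR (- limn (@ln_stirling R)) *
  Num.sqrt (4 / ((1 + m) * (1 - m))) / 2.
have kappa0 : 0 < kappa.
  rewrite divr_gt0// mulr_gt0 ?expR_gt0// sqrtr_gt0 divr_gt0// mulr_gt0//; lra.
exists kappa => // Phi Psi C c c0 PhiC mPsi PhiPsi.
have C0 : 0 <= C.
  have := PhiC 1%N 0 isT; rewrite lerN10 ler01 => /(_ isT) h.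
  rewrite -(pmulr_lge0 _ (expR_gt0 (1%:R * cw_entropy 0 - c * 1%:R * (0 - m) ^+ 2))).
  exact: le_trans h.
(* [g N k] is the k-th lattice point in the variable w. [a N k] is the k-th term of the binomial
   average divided by the cell width 2 / sqrt N, so that the step function integrates to the
   average. *)
pose g N k : R := Num.sqrt N%:R * (lattice_pt N k - m).
pose a N k : R := Num.sqrt N%:R / 2 * ('C(N, k)%:R / 2 ^+ N * Phi N (lattice_pt N k)).
have gB N k : (0 < N)%N -> g N k.+1 - g N k = 2 / Num.sqrt N%:R.
  move=> N0; have N0' : 0 < N%:R :> R by rewrite ltr0n.
  rewrite /g /lattice_pt -natr1; have := @sqr_sqrtr _ N%:R (ler0n R N).
  have : 0 < Num.sqrt N%:R :> R by rewrite sqrtr_gt0.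
  by move: (Num.sqrt N%:R) => r r0 <-; field; rewrite gt_eqF.
have gS N k : g N k <= g N k.+1.
  have [->|N0] := posnP N; first by rewrite /g sqrtr0 !mul0r.
  by rewrite -subr_ge0 gB// divr_ge0// sqrtr_ge0.
have sqrtN0 N : (0 < N)%N -> 0 < Num.sqrt N%:R :> R by rewrite sqrtr_gt0 ltr0n.
have xg N k : (0 < N)%N -> m + g N k / Num.sqrt N%:R = lattice_pt N k.
  by move=> N0; rewrite /g mulrAC divff ?gt_eqF ?sqrtN0// mul1r addrC subrK.
have gsq N k : g N k ^+ 2 = N%:R * (lattice_pt N k - m) ^+ 2.
  by rewrite /g exprMn sqr_sqrtr.
have aE N k : (0 < N)%N -> (k <= N)%N -> a N k =
    Num.sqrt N%:R * binomial_peak k (N - k) / 2 *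
    (Phi N (lattice_pt N k) * expR (- (N%:R * cw_entropy (lattice_pt N k)))).
  move=> N0 kN; rewrite /a /binomial_peak subnKC// -/(lattice_pt N k) expRN.
  by field; rewrite expR_eq0 expf_neq0.
have [K K0 peakK] := @binomial_peak_bound R m (c / 2) m1 (divr_gt0 c0 (ltr0Sn R 1)).
pose f N w := step_fun N.+1 (g N) (a N) w.
(* The domination exp (- c g^2) of the integrand and the growth exp (c g^2 / 2) of the peak leave
   exp (- c g^2 / 2). Cells have width at most 2, so w^2 <= 2 g^2 + 8, and this is at most exp (2 c)
   exp (- c w^2 / 4), a Gaussian of variance 2 / c. *)
pose G (w : R) : R := K * C * expR (2 * c) * expR (- (w ^+ 2 / (2 * (2 / c))) + 0 * w).
have fG N w : `|f N w| <= G w.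
  apply: step_fun_bound => //.
    by rewrite /G !mulr_ge0 ?expR_ge0// ltW.
  move=> k; rewrite ltnS => kN.
  (* For N = 0 all cells are empty, since the factor sqrt N vanishes. *)
  have [N0|N0] := posnP N.
    by rewrite /g N0 sqrtr0 !mul0r => /andP[/le_lt_trans/[apply]]; rewrite ltxx.
  move=> /andP[gw wg]; rewrite aE// normrM [leLHS]mulrC normrM.
  rewrite (ger0_norm (expR_ge0 _)) [X in _ * X]ger0_norm; last first.
    by rewrite divr_ge0// mulr_ge0 ?sqrtr_ge0 ?binomial_peak_ge0.
  have Phi1 : `|Phi N (lattice_pt N k)| *
      expR (- (N%:R * cw_entropy (lattice_pt N k))) <= C * expR (- (c * g N k ^+ 2)).
    rewrite expRN ler_pdivrMr ?expR_gt0// -mulrA -expRD.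
    apply: le_trans (PhiC _ _ N0 (lattice_pt_itv _ _ N0 kN)) _.
    by rewrite ler_wpM2l// ler_expR gsq addrC mulrA.
  have peak1 : Num.sqrt N%:R * binomial_peak k (N - k) / 2 <=
      K * expR (c / 2 * g N k ^+ 2).
    rewrite ler_pdivrMr//; apply: le_trans (peakK _ _ N0 kN) _.
    by rewrite gsq mulrA ler_peMr ?ler1n// mulr_ge0 ?expR_ge0// ltW.
  apply: le_trans (ler_pM _ _ Phi1 peak1) _.
  - by rewrite mulr_ge0 ?expR_ge0.
  - by rewrite divr_ge0// mulr_ge0 ?sqrtr_ge0 ?binomial_peak_ge0.
  rewrite mulrACA (mulrC C) -expRD /G -[leRHS]mulrA ler_wpM2l ?mulr_ge0 ?(ltW K0)//.
  rewrite -expRD ler_expR mul0r addr0.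
  have w2 : w < g N k + 2.
    rewrite (lt_le_trans wg)// -lerBlDl gB// ler_pdivrMr ?sqrtN0//.
    by rewrite ler_peMr// -[leLHS]sqrtr1 ler_sqrt// ler1n.
  have -> : w ^+ 2 / (2 * (2 / c)) = c / 4 * w ^+ 2 by field; rewrite gt_eqF.
  have : w ^+ 2 <= 2 * g N k ^+ 2 + 8.
    have : (w - g N k) ^+ 2 <= 4.
      have -> : 4 = 2 ^+ 2 :> R by ring.
      by rewrite ler_pXn2r ?nnegrE//; lra.
    have := sqr_ge0 (w - 2 * g N k).
    by nra.
  by nra.
have fPsi : {ae mu, forall w, setT w ->
    (fun N => (f N w)%:E) @ \oo --> (kappa * Psi w)%:E}.
  move: PhiPsi => [A [mA A0 sA]]; exists A; split => //.
  apply: subset_trans sA => w; apply: contra_not => Pw _.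
  apply: cvg_EFin; first exact: nearW.
  (* The real index at which the lattice point would be m + w / sqrt N; its integer part is the cell
     containing w. *)
  pose t N : R := (N%:R * (1 + m) + Num.sqrt N%:R * w) / 2.
  pose k N := Num.truncn (t N).
  pose z N := g N (k N).
  have sqrty : Num.sqrt (N%:R : R) @[N --> \oo] --> +oo%R.
    apply/cvgryPge => M; near=> N; rewrite (le_trans (ler_norm M))//.
    rewrite -sqrtr_sqr ler_sqrt//.
    by near: N; exact: nbhs_infty_ger.
  have isqrt0 : (Num.sqrt (N%:R : R))^-1 @[N --> \oo] --> 0.
    by apply/gtr0_cvgV0 => //; near=> N; rewrite sqrtN0//; near: N; exact: nbhs_infty_gt.
  have tN : \forall N \near \oo, [/\ (0 < N)%N, 0 <= t N & t N < N%:R].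
    near=> N; have N0 : (0 < N)%N by near: N; exact: nbhs_infty_gt.
    have w1 : Num.sqrt N%:R * (1 + m) >= - w.
      rewrite -ler_pdivrMr; last lra.
      by near: N; exact: (cvgryPge _).1 sqrty _.
    have w2 : Num.sqrt N%:R * (1 - m) > w.
      rewrite -ltr_pdivrMr; last lra.
      by near: N; exact: (cvgryPgt _).1 sqrty _.
    split => //; rewrite /t.
      rewrite divr_ge0// -{1}(@sqr_sqrtr _ N%:R)// -mulrA -mulrDr mulr_ge0 ?sqrtr_ge0//.
      by lra.
    rewrite ltr_pdivrMr// -subr_gt0.
    rewrite [ltRHS](_ : _ = Num.sqrt N%:R * (Num.sqrt N%:R * (1 - m) - w)).
      by rewrite mulr_gt0 ?sqrtN0// subr_gt0.
    by rewrite mulrBr mulrA -expr2 sqr_sqrtr//; ring.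
  have cellN : \forall N \near \oo, [/\ (0 < N)%N, (k N <= N)%N & z N <= w < g N (k N).+1].
    apply: filterS tN => N [N0 t0 tN]; have /andP[kt tk] := truncn_itv t0.
    have r0 := sqrtN0 _ N0; have rr := @sqr_sqrtr _ N%:R (ler0n R N).
    have N0' : 0 < N%:R :> R by rewrite ltr0n.
    have gE i : g N i = (2 * i%:R - N%:R * (1 + m)) / Num.sqrt N%:R.
      rewrite /g /lattice_pt.
      by move: r0 N0' rr; move: (Num.sqrt N%:R) => r r0 + <- => _; field; rewrite gt_eqF.
    split => //.
      by rewrite -ltnS -(ltr_nat R) (le_lt_trans kt)// (lt_trans tN)// ltr_nat.
    rewrite /z !gE ler_pdivrMr// ltr_pdivlMr//; move: kt tk; rewrite /k /t.
    by move: (Num.truncn _) => i; rewrite ler_pdivlMr// ltr_pdivrMr// => ? ?;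
      apply/andP; split; lra.
  have zw : z @ \oo --> w.
    apply/cvgrPdist_le => e e0; near=> N.
    have [N0 _ /andP[zle wlt]] : [/\ (0 < N)%N, (k N <= N)%N & z N <= w < g N (k N).+1].
      by near: N.
    rewrite ger0_norm ?subr_ge0//; apply: (@le_trans _ _ (2 / Num.sqrt N%:R)).
      by rewrite -(gB _ (k N) N0) lerD2r ltW.
    rewrite mulrC -ler_pdivlMr//; near: N.
    by apply: (cvgr_le _ isqrt0); rewrite divr_gt0.
  have xm : lattice_pt N (k N) @[N --> \oo] --> m.
    have : m + z N / Num.sqrt N%:R @[N --> \oo] --> m + w * 0.
      by apply: cvgD; [exact: cvg_cst|exact: cvgM].
    rewrite mulr0 addr0; apply: cvg_trans; apply: near_eq_cvg.
    by apply: filterS cellN => N [N0 _ _]; rewrite /z xg.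
  have peakm := @cvg_binomial_peak R m k m1
    (filterS (fun N => fun '(And3 _ h _) => h) cellN) xm.
  have lim : Num.sqrt N%:R * binomial_peak (k N) (N - k N) / 2 *
    (Phi N (m + z N / Num.sqrt N%:R) *
      expR (- (N%:R * cw_entropy (m + z N / Num.sqrt N%:R)))) @[N --> \oo] --> kappa * Psi w.
    apply: cvgM; last first.
      by apply: Pw.
    by rewrite /kappa; apply: cvgM; [exact: peakm|exact: cvg_cst].
  move: lim; apply: cvg_trans; apply: near_eq_cvg.
  apply: filterS cellN => N [N0 kN zN].
  by rewrite /= /f (@step_fun_cell _ _ _ _ (k N))// aE// /z xg.
have mf N : measurable_fun setT (fun w => (f N w)%:E).
  by apply/measurable_EFinP; exact: measurable_step_fun.
have iG : mu.-integrable setT (EFin \o G).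
  rewrite /G /comp; under eq_fun do rewrite EFinM.
  by apply: integrableZl => //; apply: integrable_gauss_tilt; rewrite divr_gt0.
have mkPsi : measurable_fun setT (fun w => (kappa * Psi w)%:E).
  by apply/measurable_EFinP; exact: measurable_funM.
have [ikPsi _ /= fkPsi] := @dominated_convergence _ _ _ mu _ measurableT
  (fun N w => (f N w)%:E) _ (EFin \o G) mf mkPsi fPsi iG (aeW mu (fun w N _ => fG N w)).
have iPsi : mu.-integrable setT (EFin \o Psi).
  have := integrableZl measurableT kappa^-1 ikPsi.
  by apply: eq_integrable => // w _; rewrite -EFinM mulKf// gt_eqF.
split=> //.
have kE : (\int[mu]_w (kappa * Psi w)%:E = (kappa * \int[mu]_w Psi w)%:E)%E.
  under eq_integral do rewrite EFinM.
  rewrite integralZl//.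
  by rewrite -[in LHS](fineK (integrable_fin_num measurableT iPsi)).
have : (config_avg N (Phi N))%:E @[N --> \oo] --> (kappa * \int[mu]_w Psi w)%:E.
  rewrite -kE; apply: cvg_trans fkPsi; apply: near_eq_cvg; near=> N.
  have N0 : (0 < N)%N by near: N; exact: nbhs_infty_gt.
  rewrite integral_step_fun//; congr EFin; rewrite config_avg_binomial.
  apply: eq_bigr => k _; rewrite gB// /a /lattice_pt.
  by field; rewrite expf_neq0// gt_eqF// sqrtN0.
by move=> h; exact: (fine_cvg h).
Unshelve. all: end_near.
Qed.

End laplace.

(** * The exponent H *)

Section peano.
Context {R : realType}.
Implicit Types (f df : R -> R) (m A : R).

(** Taylor's formula with Peano remainder, [df] being differentiable at m only. The remainder r
    vanishes at m and has derivative [df y - A * (y - m)], which Caratheodory's slope function shows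
    to be o(y - m); the mean value theorem then bounds r. *)
Lemma peano2 f df m A (e0 : R) : 0 < e0 ->
  (forall x : R, `|x - m| < e0 -> is_derive x 1 f (df x)) -> df m = 0 ->
  is_derive m 1 df A ->
  forall e, 0 < e -> exists2 d : R, 0 < d & forall x : R, `|x - m| < d ->
    `|f x - f m - A / 2 * (x - m) ^+ 2| <= e * (x - m) ^+ 2.
Proof.
move=> e00 fdf dfm /is_derive1_caratheodory[g [dfg cg gm]] e e1.
have /cvgrPdist_le /(_ _ e1) : g x @[x --> m] --> A by rewrite -gm; exact: cg.
move=> /nbhs_ballP[d /= d0 gd].
exists (Num.min d e0); first by rewrite lt_min d0.
move=> x; rewrite lt_min => /andP[xd xe].
pose r y : R := f y - f m - A / 2 * (y - m) ^+ 2.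
have dr y : `|y - m| < e0 -> is_derive y 1 r (df y - A * (y - m)).
  move=> ye; have fy := fdf _ ye.
  have dA : is_derive y 1 (fun y => A / 2 * ((y - m) * (y - m))) (A * (y - m)).
    by notypeclasses refine (is_derive_eqf _ _ _ _ _ _); [derivef|rewrite /=; field].
  have -> : r = (fun y => f y + (- f m - A / 2 * ((y - m) * (y - m)))).
    by apply/funext => x'; rewrite /r expr2 addrA.
  notypeclasses refine (is_derive_eqf _ _ _ _ _ _).
    notypeclasses refine (is_derive_addf _ _ _ _ _ fy _).
    notypeclasses refine (is_derive_addf _ _ _ _ _ (is_derive_cstf _ _) _).
    exact: is_derive_oppf dA.
  by rewrite add0r.
have rm : r m = 0 by rewrite /r !subrr expr0n/= mulr0 subr0.
suff [y ym rx] : exists2 y, `|y - m| <= `|x - m| & r x = (df y - A * (y - m)) * (x - m).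
  rewrite -/(r x) rx normrM -[in leRHS]real_normK ?num_real// expr2 mulrA.
  rewrite ler_wpM2r//; have := dfg y; rewrite dfm subr0 => ->.
  rewrite -mulrBl normrM ler_pM//.
  rewrite distrC; apply: gd; rewrite /ball/= distrC; exact: le_lt_trans xd.
have [xm|mx|->] := ltgtP x m; last by exists m; rewrite ?subrr ?mulr0.
- have [||y + E] := @MVT_segment R r (fun y => df y - A * (y - m)) x m (ltW xm).
  + move=> y /[!in_itv]/= /andP[xy ym]; apply: dr; apply: le_lt_trans xe.
    by rewrite !ler0_norm; lra.
  + apply/derivable_within_continuous => y /[!in_itv]/= /andP[xy ym].
    have : `|y - m| < e0 by apply: le_lt_trans xe; rewrite !ler0_norm; lra.
    by move/dr => [].
  + rewrite in_itv/= => /andP[xy ym]; exists y; first by rewrite !ler0_norm; lra.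
    by move: E; rewrite rm sub0r => /eqP; rewrite eqr_oppLR -mulrN opprB => /eqP.
- have [||y + E] := @MVT_segment R r (fun y => df y - A * (y - m)) m x (ltW mx).
  + move=> y /[!in_itv]/= /andP[my yx]; apply: dr; apply: le_lt_trans xe.
    by rewrite !ger0_norm; lra.
  + apply/derivable_within_continuous => y /[!in_itv]/= /andP[my yx].
    have : `|y - m| < e0 by apply: le_lt_trans xe; rewrite !ger0_norm; lra.
    by move/dr => [].
  + rewrite in_itv/= => /andP[my yx]; exists y; first by rewrite !ger0_norm; lra.
    by move: E; rewrite rm subr0.
Qed.

Lemma cvg_sqrtr_pinfty : Num.sqrt (N%:R : R) @[N --> \oo] --> +oo%R.
Proof.
apply/cvgryPge => M; near=> N; rewrite (le_trans (ler_norm M))//.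
rewrite -sqrtr_sqr ler_sqrt//.
by near: N; exact: nbhs_infty_ger.
Unshelve. all: end_near. Qed.

Lemma cvg_divr_sqrt (z : nat -> R) (w : R) : z @ \oo --> w ->
  z N / Num.sqrt (N%:R : R) @[N --> \oo] --> (0 : R).
Proof.
move=> zw; rewrite -(mulr0 w); apply: cvgM => //.
apply/gtr0_cvgV0; last exact: cvg_sqrtr_pinfty.
by near=> N; rewrite sqrtr_gt0 ltr0n; near: N; exact: nbhs_infty_gt.
Unshelve. all: end_near. Qed.

Lemma peano2_cvg f df m A (e0 : R) : 0 < e0 ->
  (forall x : R, `|x - m| < e0 -> is_derive x 1 f (df x)) -> df m = 0 ->
  is_derive m 1 df A -> forall (z : nat -> R) (w : R), z @ \oo --> w ->
  N%:R * (f (m + z N / Num.sqrt N%:R) - f m) @[N --> \oo] --> A / 2 * w ^+ 2.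
Proof.
move=> e00 fdf dfm dfA z w zw.
have z2 : (z N) ^+ 2 @[N --> \oo] --> w ^+ 2.
  by rewrite expr2; under eq_fun do rewrite expr2; exact: cvgM.
have z2A : A / 2 * (z N) ^+ 2 @[N --> \oo] --> A / 2 * w ^+ 2 by apply: cvgMr.
pose F N : R := N%:R * (f (m + z N / Num.sqrt N%:R) - f m).
pose Q N : R := A / 2 * (z N) ^+ 2.
suff h : F N - Q N @[N --> \oo] --> (0 : R).
  change (F @ \oo --> A / 2 * w ^+ 2).
  have -> : F = (fun N => (F N - Q N) + Q N) by apply/funext => N; rewrite subrK.
  by rewrite -[X in _ --> X]add0r; exact: cvgD.
rewrite /F /Q.
apply/cvgrPdist_le => e ep.
pose M := w ^+ 2 + 1.
have M0 : 0 < M by rewrite /M ltr_wpDl ?sqr_ge0.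
have [d d0 fd] := peano2 _ _ _ _ _ e00 fdf dfm dfA _ (divr_gt0 ep M0).
near=> N; rewrite sub0r normrN.
have N0 : (0 < N)%N by near: N; exact: nbhs_infty_gt.
have N0' : 0 < N%:R :> R by rewrite ltr0n.
have xd : `|m + z N / Num.sqrt N%:R - m| < d.
  rewrite addrC addKr -normrN -sub0r.
  by near: N; move: (cvg_divr_sqrt _ _ zw) => /cvgrPdist_lt/(_ _ d0).
have e1 : (z N / Num.sqrt N%:R) ^+ 2 = z N ^+ 2 / N%:R :> R.
  by rewrite expr_div_n sqr_sqrtr.
have xmE (u : R) : m + u - m = u by rewrite addrC addKr.
have := fd _ xd; rewrite xmE e1 => h.
rewrite [X in `|X|](_ : _ = N%:R *
    (f (m + z N / Num.sqrt N%:R) - f m - A / 2 * (z N ^+ 2 / N%:R))); last first.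
  by field; rewrite gt_eqF.
rewrite normrM ger0_norm//; apply: le_trans (ler_wpM2l _ h) _ => //.
rewrite [leLHS](_ : _ = e / M * z N ^+ 2); last by field; rewrite !gt_eqF.
rewrite mulrAC ler_pdivrMr// ler_wpM2l ?(ltW ep)//.
by near: N; apply: (cvgr_le _ z2); rewrite /M ltrDl.
Unshelve. all: end_near. Qed.

Lemma max_gap f (a b : R) m : {within `[a, b], continuous f} ->
  (forall x : R, a <= x <= b -> f x < f m) ->
  exists2 eta : R, 0 < eta & forall x : R, a <= x <= b -> f x <= f m - eta.
Proof.
move=> cf fm; have [ab|ba] := leP a b; last first.
  by exists 1 => // x /andP[ax xb]; have := le_trans ax xb; rewrite leNgt ba.
have [c cab fc] := EVT_max ab cf; exists (f m - f c).
  by rewrite subr_gt0 fm//; move: cab; rewrite in_itv.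
by move=> x xab; rewrite subKr fc// in_itv.
Qed.

(** Near m, Taylor's formula with error - A / 4 leaves half of the quadratic term. Elsewhere
    compactness gives a uniform gap eta, which is quadratic because (x - m)^2 <= 4 on [-1, 1]. This
    is the source of the Gaussian domination in Laplace's method. *)
Lemma quadratic_gap f df m A : {within `[-1, 1], continuous f} -> -1 < m < 1 ->
  (forall x : R, -1 < x < 1 -> is_derive x 1 f (df x)) -> df m = 0 ->
  is_derive m 1 df A -> A < 0 ->
  (forall x : R, -1 <= x <= 1 -> x != m -> f x < f m) ->
  exists2 c : R, 0 < c & forall x : R, -1 <= x <= 1 -> f x - f m <= - c * (x - m) ^+ 2.
Proof.
move=> cf m1 fdf dfm dfA A0 fm.
have e0 : 0 < Num.min (1 - m) (1 + m) by rewrite lt_min; apply/andP; split; lra.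
have fdf' x : `|x - m| < Num.min (1 - m) (1 + m) -> is_derive x 1 f (df x).
  by rewrite lt_min !ltr_norml => ?; apply: fdf; lra.
have A4 : 0 < - A / 4 by rewrite divr_gt0// oppr_gt0.
have [d d0 fd] := peano2 _ _ _ _ _ e0 fdf' dfm dfA _ A4.
have sub a b : -1 <= a -> b <= 1 -> {within `[a, b], continuous f}.
  move=> a1 b1; apply: continuous_subspaceW cf => x /=.
  by rewrite !in_itv/= => ?; lra.
have [eta1 eta10 f1] : exists2 eta : R, 0 < eta &
    forall x : R, -1 <= x <= m - d -> f x <= f m - eta.
  apply: max_gap; first by apply: sub => //; lra.
  by move=> x xm; apply: fm; [lra|rewrite lt_eqF//; lra].
have [eta2 eta20 f2] : exists2 eta : R, 0 < eta &
    forall x : R, m + d <= x <= 1 -> f x <= f m - eta.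
  apply: max_gap; first by apply: sub => //; lra.
  by move=> x xm; apply: fm; [lra|rewrite gt_eqF//; lra].
exists (Num.min (- A / 4) (Num.min (eta1 / 4) (eta2 / 4))).
  by rewrite !lt_min A4 !divr_gt0.
set c := Num.min _ _ => x x1.
have c0 : 0 <= c by rewrite !le_min !ltW// divr_gt0.
have cA : c <= - A / 4 by rewrite ge_min lexx.
have c1 : c <= eta1 / 4 by rewrite !ge_min lexx orbT.
have c2 : c <= eta2 / 4 by rewrite !ge_min lexx !orbT.
have x2 : (x - m) ^+ 2 <= 4.
  have -> : 4 = 2 ^+ 2 :> R by ring.
  by rewrite -[leLHS]real_normK ?num_real// ler_pXn2r ?nnegrE// ler_norml; lra.
have x20 := sqr_ge0 (x - m).
have [xd|] := ltP `|x - m| d.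
  have := fd _ xd; rewrite ler_norml => /andP[_ h].
  have : c * (x - m) ^+ 2 <= - A / 4 * (x - m) ^+ 2 by rewrite ler_wpM2r.
  by lra.
have far eta : 0 < eta -> c <= eta / 4 -> f x <= f m - eta -> f x - f m <= - c * (x - m) ^+ 2.
  move=> eta0 ce fx; have : c * (x - m) ^+ 2 <= eta / 4 * 4.
    by apply: ler_pM.
  by lra.
rewrite ler_normr => /orP[dx|dx].
- by apply: (far _ eta20 c2); apply: f2; lra.
- by apply: (far _ eta10 c1); apply: f1; lra.
Qed.

End peano.

Section hamiltonian.
Context {R : realType}.
Implicit Types (b h x m : R) (p : nat).

(** On the negative half-line the function is 0, as [ln] is. At 0, writing s = (sqrt s)^2 and using
    ln (1 / sqrt s) < 1 / sqrt s bounds |s ln s| by 2 sqrt s. This makes the entropy continuous at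
    the endpoints -1 and 1. *)
Lemma continuous_xlnx : continuous (fun t : R => t * ln t).
Proof.
move=> t; have [t0|t0|->] := ltgtP t 0.
- rewrite /continuous_at (ln0 (ltW t0)) mulr0.
  apply: cvg_near_cst; near=> s; rewrite ln0 ?mulr0//.
  by apply: ltW; near: s; apply: lt_nbhsl.
- by apply: cvgM; [exact: cvg_id|exact: continuous_ln].
rewrite /continuous_at mul0r; apply/cvgrPdist_le => e e0.
have : Num.sqrt s @[s --> (0 : R)] --> (0 : R).
  by rewrite -[X in _ --> X]sqrtr0; exact: sqrt_continuous.
move=> /cvgrPdist_le/(_ _ (divr_gt0 e0 (ltr0Sn R 1))) sqrt_e.
near=> s; rewrite sub0r normrN.
have [s0|s0] := leP s 0; first by rewrite ln0// mulr0 normr0 ltW.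
have s1 : s <= 1 by apply: ltW; near: s; apply: lt_nbhsl.
have r0 : 0 < Num.sqrt s by rewrite sqrtr_gt0.
have se : Num.sqrt s <= e / 2.
  by rewrite -[leLHS]ger0_norm ?sqrtr_ge0// -normrN -sub0r; near: s.
rewrite -[X in `|X|]opprK normrN -mulrN -lnV//.
have -> : ln s^-1 = 2 * ln (Num.sqrt s)^-1.
  by rewrite -{1}(@sqr_sqrtr _ s (ltW s0)) -exprVn lnXn ?invr_gt0// mulr_natl.
have l0 : 0 <= ln (Num.sqrt s)^-1.
  by rewrite ln_ge0// invf_ge1// -sqrtr1 ler_sqrt.
have l1 : ln (Num.sqrt s)^-1 <= (Num.sqrt s)^-1.
  by rewrite ltW// ln_sublinear// invr_gt0.
rewrite ger0_norm; last by rewrite !mulr_ge0// ltW.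
rewrite -{1}(@sqr_sqrtr _ s (ltW s0)).
apply: (@le_trans _ _ (Num.sqrt s ^+ 2 * (2 * (Num.sqrt s)^-1))).
  by rewrite !ler_wpM2l// sqr_ge0.
by rewrite mulrCA expr2 mulfK ?gt_eqF//; lra.
Unshelve. all: end_near. Qed.

Lemma continuous_cw_entropy : continuous (@cw_entropy R).
Proof.
move=> x; rewrite /cw_entropy; apply: cvgMr; apply: cvgD.
- apply: (@continuous_comp _ _ _ (fun x => 1 + x) (fun t => t * ln t)).
    by apply: cvgD; [exact: cvg_cst|exact: cvg_id].
  exact: continuous_xlnx.
- apply: (@continuous_comp _ _ _ (fun x => 1 - x) (fun t => t * ln t)).
    by apply: cvgB; [exact: cvg_cst|exact: cvg_id].
  exact: continuous_xlnx.
Qed.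

Lemma continuous_cw_H b h p : continuous (cw_H b h p).
Proof.
move=> x; rewrite /cw_H; apply: cvgB; last exact: continuous_cw_entropy.
apply: cvgD; apply: cvgMr; last exact: cvg_id.
exact: exprn_continuous.
Qed.

Definition cw_dentropy x : R := 2^-1 * (ln (1 + x) - ln (1 - x)).

Definition cw_dH b h p x : R := b * (p%:R * x ^+ p.-1) + h - cw_dentropy x.

Definition cw_ddH b p x : R :=
  b * (p%:R * (p.-1%:R * x ^+ p.-2)) - (1 - x ^+ 2)^-1.

Lemma is_derive_cw_entropy x : -1 < x < 1 ->
  is_derive x 1 (@cw_entropy R) (cw_dentropy x).
Proof.
move=> /andP[x1 x2]; have x1' : 0 < 1 + x by lra. have x2' : 0 < 1 - x by lra.
rewrite /cw_entropy; notypeclasses refine (is_derive_eqf _ _ _ _ _ _).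
  by derivef.
by rewrite /cw_dentropy /=; field; rewrite !gt_eqF.
Qed.

Lemma is_derive_cw_dentropy x : -1 < x < 1 ->
  is_derive x 1 cw_dentropy (1 - x ^+ 2)^-1.
Proof.
move=> /andP[x1 x2]; have x1' : 0 < 1 + x by lra. have x2' : 0 < 1 - x by lra.
rewrite /cw_dentropy; notypeclasses refine (is_derive_eqf _ _ _ _ _ _).
  by derivef.
have -> : 1 - x ^+ 2 = (1 + x) * (1 - x) by ring.
by rewrite /=; field; rewrite !gt_eqF.
Qed.

Lemma is_derive_cw_H b h p x : -1 < x < 1 ->
  is_derive x 1 (cw_H b h p) (cw_dH b h p x).
Proof.
move=> x1; have := is_derive_cw_entropy _ x1; rewrite /cw_H => dI.
notypeclasses refine (is_derive_eqf _ _ _ _ _ _).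
  notypeclasses refine (is_derive_addf _ _ _ _ _ _ (is_derive_oppf _ _ _ dI)).
  by derivef.
by rewrite /cw_dH /=; ring.
Qed.

Lemma is_derive_cw_dH b h p x : -1 < x < 1 ->
  is_derive x 1 (cw_dH b h p) (cw_ddH b p x).
Proof.
move=> x1; have := is_derive_cw_dentropy _ x1; rewrite /cw_dH => dI.
notypeclasses refine (is_derive_eqf _ _ _ _ _ _).
  notypeclasses refine (is_derive_addf _ _ _ _ _ _ (is_derive_oppf _ _ _ dI)).
  by derivef.
by rewrite /cw_ddH /=; ring.
Qed.

Lemma cw_H_derive2 b h p x : -1 < x < 1 ->
  ((cw_H b h p)^`(2))%classic x = cw_ddH b p x.
Proof.
move=> x1; rewrite !derive1nS derive1n0 derive1E.
have [_ <-] := is_derive_cw_dH b h p x x1.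
move/andP: x1 => [x1 x2]; apply: near_eq_derive; near=> y; rewrite derive1E.
have y1 : -1 < y < 1.
  by apply/andP; split; near: y; [exact: lt_nbhsr|exact: lt_nbhsl].
by have [_ <-] := is_derive_cw_H b h p y y1.
Unshelve. all: end_near. Qed.

Lemma cw_entropyN x : cw_entropy (- x) = cw_entropy x.
Proof. by rewrite /cw_entropy opprK addrC. Qed.

Lemma cw_entropy0 : cw_entropy 0 = 0 :> R.
Proof. by rewrite /cw_entropy addr0 subr0 ln1 mulr0 addr0 mulr0. Qed.

(** The second derivative 1 / (1 - x^2) is at least 1; integrate twice from 0. At the endpoint,
    where the derivative is infinite, ln 2 >= 2/3 suffices. *)
Lemma cw_entropy_ge x : -1 <= x <= 1 -> x ^+ 2 / 2 <= cw_entropy x.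
Proof.
wlog x0 : x / 0 <= x.
  move=> hx x1; have [/hx->//|x0] := leP 0 x.
  by rewrite -sqrrN -cw_entropyN; apply: hx; lra.
suff h (y : R) : 0 <= y < 1 -> y ^+ 2 / 2 <= cw_entropy y.
  move=> /andP[_]; rewrite le_eqVlt => /predU1P[->|x1]; last by apply: h; rewrite x0.
  have -> : cw_entropy 1 = ln 2 :> R.
    rewrite /cw_entropy subrr mul0r addr0 (_ : 1 + 1 = 2); last by ring.
    by rewrite mulKf.
  have := @ln1D_ge R 1 ler01; rewrite (_ : 1 + 1 = 2); last by ring.
  by apply: le_trans; rewrite expr1n mulr1 (_ : 2 + 1 = 3); [lra|ring].
move=> /andP[y0 y1].
have dd (z : R) : 0 <= z < 1 -> 0 <= cw_dentropy z - z.
  move=> /andP[z0 z1].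
  apply: (@ge0_of_derive R (fun x => cw_dentropy x - x)
    (fun x => (1 - x ^+ 2)^-1 - 1)); last exact: z0.
  - move=> t /andP[t0 tz]; notypeclasses refine (is_derive_addf _ _ _ _ _ _ _).
      by apply: is_derive_cw_dentropy; lra.
    by apply: is_derive_oppf; exact: is_derive_idf.
  - move=> t /andP[t0 tz]; rewrite subr_ge0 invf_ge1; nra.
  - by rewrite /cw_dentropy addr0 !subr0 subrr mulr0.
rewrite -subr_ge0.
apply: (@ge0_of_derive R (fun x => cw_entropy x - x ^+ 2 / 2)
  (fun x => cw_dentropy x - x)); last exact: y0.
- move=> t /andP[t0 ty]; notypeclasses refine (is_derive_addf _ _ _ _ _ _ _).
    by apply: is_derive_cw_entropy; lra.
  by notypeclasses refine (is_derive_eqf _ _ _ _ _ _); [derivef|rewrite /=; field].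
- by move=> t /andP[t0 ty]; apply: dd; rewrite t0 (le_lt_trans ty).
- by rewrite cw_entropy0 expr0n/= mul0r subrr.
Qed.

Lemma cw_dH_max b h p m : -1 < m < 1 ->
  (forall x : R, -1 <= x <= 1 -> cw_H b h p x <= cw_H b h p m) -> cw_dH b h p m = 0.
Proof.
move=> m1 hm; have d1 := is_derive_cw_H b h p m m1.
have [] := @derive1_at_max R (cw_H b h p) (-1) 1 m.
- lra.
- by move=> t /[!in_itv]/= /(is_derive_cw_H b h p) [].
- by rewrite in_itv.
- by move=> t /[!in_itv]/= t1; apply: hm; lra.
by move=> _ <-; case: d1.
Qed.

Lemma cw_H_gap b h p m : -1 < m < 1 -> cw_ddH b p m < 0 ->
  cw_maximizers b h p = [set m] ->
  exists2 c : R, 0 < c & forall x : R, -1 <= x <= 1 ->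
    cw_H b h p x - cw_H b h p m <= - c * (x - m) ^+ 2.
Proof.
move=> m1 H2 hm.
have [_ mmax] : cw_maximizers b h p m by rewrite hm.
have mmax' (x : R) : -1 <= x <= 1 -> cw_H b h p x <= cw_H b h p m.
  by move=> x1; apply: mmax; rewrite in_itv.
apply: (quadratic_gap (cw_H b h p) (cw_dH b h p) m (cw_ddH b p m)).
- exact/continuous_subspaceT/continuous_cw_H.
- exact: m1.
- by move=> x; exact: is_derive_cw_H.
- exact: cw_dH_max.
- exact: is_derive_cw_dH.
- exact: H2.
- move=> x x1 xm; rewrite lt_neqAle mmax'// andbT; apply: contra_neq xm => Hx.
  have : cw_maximizers b h p x.
    split; first by rewrite in_itv.
    by move=> y; rewrite in_itv/= Hx; exact: mmax'.
  by rewrite hm.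
Qed.

Lemma cvg_cw_H b h p m (z : nat -> R) (w : R) : -1 < m < 1 ->
  cw_dH b h p m = 0 -> z @ \oo --> w ->
  N%:R * (cw_H b h p (m + z N / Num.sqrt N%:R) - cw_H b h p m) @[N --> \oo] -->
  cw_ddH b p m / 2 * w ^+ 2.
Proof.
move=> m1 dH0 zw.
have e0 : 0 < Num.min (1 - m) (1 + m) by rewrite lt_min; apply/andP; split; lra.
apply: (peano2_cvg _ (cw_dH b h p) _ _ _ e0).
- by move=> x; rewrite lt_min !ltr_norml => ?; apply: is_derive_cw_H; lra.
- exact: dH0.
- exact: is_derive_cw_dH.
- exact: zw.
Qed.

(** The entropy is - H with all parameters 0, for which the second derivative at 0 is -1. *)
Lemma cvg_cw_entropy (z : nat -> R) (w : R) : z @ \oo --> w ->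
  N%:R * cw_entropy (0 + z N / Num.sqrt N%:R) @[N --> \oo] --> w ^+ 2 / 2.
Proof.
move=> zw; have m1 : -1 < (0 : R) < 1 by lra.
have dH0 : cw_dH 0 0 0 (0 : R) = 0.
  by rewrite /cw_dH /cw_dentropy !addr0 subr0 subrr mulr0 subr0 mul0r.
have -> : w ^+ 2 / 2 = - (cw_ddH 0 0 (0 : R) / 2 * w ^+ 2).
  by rewrite /cw_ddH !expr0n/= subr0 invr1 mul0r sub0r; field.
have -> : (fun N => N%:R * cw_entropy (0 + z N / Num.sqrt N%:R)) =
    (fun N => - (N%:R * (cw_H 0 0 0 (0 + z N / Num.sqrt N%:R) - cw_H 0 0 0 0))).
  by apply/funext => N; rewrite /cw_H cw_entropy0; ring.
exact: cvgN (cvg_cw_H _ _ _ _ _ _ m1 dH0 zw).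
Qed.

End hamiltonian.

(** * The maximum likelihood estimate *)

Section likelihood.
Context {R : realType}.
Implicit Types (b h x : R) (p N : nat).

Section convex_minimizers.
Variable q : R -> R.
Hypothesis cq : continuous q.
Hypothesis convex_q : forall b1 b2 b3, b1 < b2 -> b2 < b3 ->
  (b3 - b1) * q b2 <= (b3 - b2) * q b1 + (b2 - b1) * q b3.

(** If q fails to decrease from some b to some b' > b, convexity keeps q above q b' to the right of
    b', while the drop from b1 to b0 keeps it above q b1 to the left of b1. A minimum over a compact
    interval containing all four points is then global. *)
Lemma convex_minimizer_or_decr b1 b0 : b1 < b0 -> q b0 < q b1 ->
  (exists c, forall b, q c <= q b) \/ (forall b b', b < b' -> q b' < q b).
Proof.
move=> b10 q01.
have [decr|] := pselect (forall b b', b < b' -> q b' < q b); first by right.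
move=> /existsNP[b /existsNP[b' /not_implyP[bb' /negP]]]; rewrite -leNgt => qbb'.
left; pose lo := Num.min b b1; pose hi := Num.max b' b0.
have lohi : lo <= hi by rewrite ge_min le_max (ltW bb').
have [c _ cmin] := EVT_min lohi (continuous_subspaceT cq).
have qb' : q c <= q b'.
  by apply: cmin; rewrite in_itv/= ge_min (ltW bb') le_max lexx.
have qb1 : q c <= q b1.
  by apply: cmin; rewrite in_itv/= ge_min lexx orbT le_max (ltW b10) orbT.
exists c => x; have [xlo|lox] := ltP x lo.
  have xb1 : x < b1 by rewrite (lt_le_trans xlo)// ge_min lexx orbT.
  have := convex_q _ _ _ xb1 b10; have : 0 < b0 - b1 by rewrite subr_gt0.
  have : 0 < b1 - x by rewrite subr_gt0.
  by nra.
have [hix|xhi] := ltP hi x; last by apply: cmin; rewrite in_itv/= lox.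
have b'x : b' < x by rewrite (le_lt_trans _ hix)// le_max lexx.
have := convex_q _ _ _ bb' b'x; have : 0 < b' - b by rewrite subr_gt0.
have : 0 < x - b' by rewrite subr_gt0.
by nra.
Qed.

(** A minimizer c < b1 would make q b1 at most a weighted mean of q c and q b0, hence at most q
    b0. *)
Lemma convex_minimizer_ge b1 b0 c : b1 < b0 -> q b0 < q b1 ->
  (forall b, q c <= q b) -> b1 <= c.
Proof.
move=> b10 q01 cmin; rewrite leNgt; apply/negP => cb1.
have := convex_q _ _ _ cb1 b10; have := cmin b0.
have : 0 < b0 - b1 by rewrite subr_gt0.
have : 0 < b1 - c by rewrite subr_gt0.
by nra.
Qed.

Lemma convex_minimizer_le b0 b2 c : b0 < b2 -> q b0 < q b2 ->
  (forall b, q c <= q b) -> c <= b2.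
Proof.
move=> b02 q02 cmin; rewrite leNgt; apply/negP => b2c.
have := convex_q _ _ _ b02 b2c; have := cmin b0.
have : 0 < b2 - b0 by rewrite subr_gt0.
have : 0 < c - b2 by rewrite subr_gt0.
by nra.
Qed.

End convex_minimizers.

Definition cw_likelihood h p N x b : R :=
  (2 ^+ N * cw_partition b h p N)^-1 * expR (N%:R * (b * x ^+ p + h * x)).

(* A configuration enters [mle] only through its magnetization: [mle h p s] is
   convertible to [mle_of h p N (magnetization s)]. *)
Definition mle_of h p N x : \bar R :=
  let M := [set b | forall b', cw_likelihood h p N x b' <= cw_likelihood h p N x b] in
  if `[< M !=set0 >] then (xget 0 M)%:E
  else if `[< {homo cw_likelihood h p N x : b b' / b < b'} >] then +oo%E else -oo%E.

(* [2 ^ N * inv_likelihood] is the inverse of the likelihood; it is an average of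
   exponentials in [b], hence convex, so comparing its values at two parameters
   bounds [mle_of] on one side. *)
Definition inv_likelihood h p N x b : R :=
  config_avg N (fun y => expR (N%:R * (b * (y ^+ p - x ^+ p) + h * (y - x)))).

Lemma config_avg_gt0 N (F : R -> R) : (forall y, 0 < F y) -> 0 < config_avg N F.
Proof.
move=> F0; rewrite mulr_gt0 ?invr_gt0 ?exprn_gt0//.
rewrite (bigD1 [ffun=> true])//= ltr_pwDl//.
by apply: sumr_ge0 => *; exact: ltW.
Qed.

Lemma config_avgZ N k (F : R -> R) :
  config_avg N (fun y => k * F y) = k * config_avg N F.
Proof. by rewrite /config_avg -mulr_sumr mulrCA. Qed.

Lemma config_avgD N (F G : R -> R) :
  config_avg N (fun y => F y + G y) = config_avg N F + config_avg N G.
Proof. by rewrite /config_avg big_split/= mulrDr. Qed.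

Lemma config_avgB N (F G : R -> R) :
  config_avg N (fun y => F y - G y) = config_avg N F - config_avg N G.
Proof. by rewrite /config_avg sumrB mulrBr. Qed.

Lemma ler_config_avg N (F G : R -> R) : (forall y, -1 <= y <= 1 -> F y <= G y) ->
  config_avg N F <= config_avg N G.
Proof.
move=> FG; rewrite ler_wpM2l ?invr_ge0 ?exprn_ge0//.
by apply: ler_sum => s _; apply: FG; exact: magnetization_itv.
Qed.

Lemma inv_likelihood_gt0 h p N x b : 0 < inv_likelihood h p N x b.
Proof. by apply: config_avg_gt0 => y; exact: expR_gt0. Qed.

Lemma cw_partitionE b h p N : cw_partition b h p N =
  config_avg N (fun y => expR (N%:R * (b * y ^+ p + h * y))).
Proof. by []. Qed.

Lemma inv_likelihoodE h p N x b : inv_likelihood h p N x b =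
  cw_partition b h p N * expR (- (N%:R * (b * x ^+ p + h * x))).
Proof.
rewrite cw_partitionE mulrC -config_avgZ; congr config_avg; apply/funext => y.
by rewrite -expRD; congr expR; ring.
Qed.

Lemma cw_likelihoodE h p N x b :
  cw_likelihood h p N x b = (2 ^+ N * inv_likelihood h p N x b)^-1.
Proof. by rewrite inv_likelihoodE expRN mulrA invfM invrK. Qed.

Lemma cw_likelihood_lt h p N x b b' : (cw_likelihood h p N x b < cw_likelihood h p N x b')
  = (inv_likelihood h p N x b' < inv_likelihood h p N x b).
Proof.
have pow0 : 0 < 2 ^+ N :> R by rewrite exprn_gt0.
have lik0 c : 2 ^+ N * inv_likelihood h p N x c \is Num.pos.
  by rewrite posrE mulr_gt0// inv_likelihood_gt0.
by rewrite !cw_likelihoodE ltf_pV2// ltr_pM2l.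
Qed.

Lemma cw_likelihood_le h p N x b b' : (cw_likelihood h p N x b <= cw_likelihood h p N x b')
  = (inv_likelihood h p N x b' <= inv_likelihood h p N x b).
Proof. by rewrite leNgt cw_likelihood_lt -leNgt. Qed.

Lemma continuous_inv_likelihood h p N x : continuous (inv_likelihood h p N x).
Proof.
have cs : continuous (fun b => \sum_(s : config N)
    expR (N%:R * (b * (magnetization s ^+ p - x ^+ p) + h * (magnetization s - x)))).
  apply: continuous_big => [|s _ b]; first exact: add_continuous.
  apply: continuous_cvg; first exact: continuous_expR.
  apply: cvgMr; apply: cvgD; last exact: cvg_cst.
  by apply: cvgMl; exact: cvg_id.
by move=> b; apply: cvgMr; exact: cs.
Qed.

Lemma convex_inv_likelihood h p N x b1 b2 b3 : b1 < b2 -> b2 < b3 ->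
  (b3 - b1) * inv_likelihood h p N x b2 <=
  (b3 - b2) * inv_likelihood h p N x b1 + (b2 - b1) * inv_likelihood h p N x b3.
Proof.
move=> b12 b23; rewrite /inv_likelihood -!config_avgZ -config_avgD.
apply: ler_config_avg => y _.
set D := y ^+ p - x ^+ p; set A := N%:R * (b2 * D + h * (y - x)).
(* The tangent of the exponential at b2; in the weighted sum over b1 and b3 the slopes cancel. *)
have E b : expR A * (1 + N%:R * ((b - b2) * D)) <= expR (N%:R * (b * D + h * (y - x))).
  rewrite (_ : N%:R * (b * D + h * (y - x)) = A + N%:R * ((b - b2) * D)).
    by rewrite expRD ler_wpM2l ?expR_ge0// expR_ge1Dx.
  by rewrite /A; ring.
have b32 : 0 <= b3 - b2 by rewrite subr_ge0 ltW.
have b21 : 0 <= b2 - b1 by rewrite subr_ge0 ltW.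
apply: le_trans (lerD (ler_wpM2l b32 (E b1)) (ler_wpM2l b21 (E b3))).
by rewrite le_eqVlt; apply/orP; left; apply/eqP; ring.
Qed.

(** The value -oo is excluded by the dichotomy: without a minimizer the inverse likelihood strictly
    decreases, and the estimate is +oo. *)
Lemma mle_of_ge h p N x b1 b0 : b1 < b0 ->
  inv_likelihood h p N x b0 < inv_likelihood h p N x b1 ->
  (b1%:E <= mle_of h p N x)%E.
Proof.
move=> b10 q01; rewrite /mle_of; set M := [set b | _].
have MP c : M c <-> forall b, inv_likelihood h p N x c <= inv_likelihood h p N x b.
  by split=> Mc b; have := Mc b; rewrite cw_likelihood_le.
have cq := @continuous_inv_likelihood h p N x.
have cvq := @convex_inv_likelihood h p N x.
case: asboolP => [M0|M0].
  rewrite lee_fin; apply: (convex_minimizer_ge _ cvq _ _ _ b10 q01).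
  by apply/MP; exact: xgetPex.
case: asboolP => [_|]; first exact: leey.
case: (convex_minimizer_or_decr _ cq cvq _ _ b10 q01) => [[c cM]|decr].
  by exfalso; apply: M0; exists c; exact/MP.
by case=> b b' bb' /=; rewrite cw_likelihood_lt decr.
Qed.

Lemma mle_of_le h p N x b0 b2 : b0 < b2 ->
  inv_likelihood h p N x b0 < inv_likelihood h p N x b2 ->
  (mle_of h p N x <= b2%:E)%E.
Proof.
move=> b02 q02; rewrite /mle_of; set M := [set b | _].
have MP c : M c <-> forall b, inv_likelihood h p N x c <= inv_likelihood h p N x b.
  by split=> Mc b; have := Mc b; rewrite cw_likelihood_le.
have cvq := @convex_inv_likelihood h p N x.
case: asboolP => [M0|M0].
  rewrite lee_fin; apply: (convex_minimizer_le _ cvq _ _ _ b02 q02).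
  by apply/MP; exact: xgetPex.
case: asboolP => [/(_ _ _ b02)|_]; last exact: leNye.
by rewrite /= cw_likelihood_lt ltNge (ltW q02).
Qed.

Lemma cvge_between (X : nat -> \bar R) (l : R) :
  (forall e, 0 < e -> \forall N \near \oo,
     ((l - e)%:E <= X N)%E /\ (X N <= (l + e)%:E)%E) ->
  X @ \oo --> l%:E.
Proof.
move=> Xl; apply/fine_cvgP; split.
  apply: filterS (Xl _ ltr01) => N [+ +]; rewrite fin_numE.
  by case: (X N).
apply/cvgrPdist_le => e e0; apply: filterS (Xl _ e0) => N /=.
case: (X N) => [r| |] [] //=; rewrite !lee_fin => ? ?.
by rewrite ler_norml; apply/andP; split; lra.
Qed.

End likelihood.

(** * Nonzero magnetization *)

Section tilted_laplace.
Context {R : realType}.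
Notation mu := (@lebesgue_measure R).
Implicit Types (b h x m : R) (p N : nat).

Lemma ler_norm_expB p x y : `|x| <= 1 -> `|y| <= 1 ->
  `|x ^+ p - y ^+ p| <= p%:R * `|x - y| :> R.
Proof.
move=> x1 y1; elim: p => [|p IH]; first by rewrite !expr0 subrr normr0 mul0r.
have -> : x ^+ p.+1 - y ^+ p.+1 = x * (x ^+ p - y ^+ p) + (x - y) * y ^+ p.
  by rewrite !exprS; ring.
rewrite (le_trans (ler_normD _ _))// !normrM -natr1 mulrDl mul1r lerD//.
  by rewrite (le_trans (ler_piMl _ x1)).
by rewrite ler_piMr// normrX exprn_ile1.
Qed.

Lemma cvg_expB m p (z : nat -> R) (w : R) : z @ \oo --> w ->
  Num.sqrt N%:R * ((m + z N / Num.sqrt N%:R) ^+ p - m ^+ p) @[N --> \oo] -->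
  p%:R * m ^+ p.-1 * w.
Proof.
move=> zw; have /is_derive1_caratheodory[g [gE cg <-]] := is_derive_expf p m.
have xm : m + z N / Num.sqrt N%:R @[N --> \oo] --> m.
  rewrite -[X in _ --> X]addr0; apply: cvgD; first exact: cvg_cst.
  exact: cvg_divr_sqrt zw.
have : g (m + z N / Num.sqrt N%:R) * z N @[N --> \oo] --> g m * w.
  by apply: cvgM => //; exact: (cvg_comp _ _ xm cg).
apply: cvg_trans; apply: near_eq_cvg; near=> N.
have r0 : 0 < Num.sqrt N%:R :> R.
  by rewrite sqrtr_gt0 ltr0n; near: N; exact: nbhs_infty_gt.
have xmE (u : R) : m + u - m = u by rewrite addrC addKr.
by rewrite gE xmE; field; rewrite gt_eqF.
Unshelve. all: end_near. Qed.

(** One statement for both uses: G = 1 gives the inverse likelihood at b + u / sqrt N up to a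
    factor, and u = 0 gives the expectation of G. Since y^p is Lipschitz on [-1, 1], the tilt is at
    most linear in s = sqrt N |y - m|, and half of the quadratic gap absorbs it. *)
Theorem laplace_tilt b h p m c : -1 < m < 1 -> cw_dH b h p m = 0 -> 0 < c ->
  (forall x : R, -1 <= x <= 1 ->
    cw_H b h p x - cw_H b h p m <= - c * (x - m) ^+ 2) ->
  exists2 kappa : R, 0 < kappa &
  forall (G : nat -> R -> R) (g : R -> R) (B : R) (zeta : nat -> R) (L u : R),
  (forall N y, `|G N y| <= B) -> measurable_fun setT g ->
  {ae mu, forall w, forall z : nat -> R, z @ \oo --> w ->
    G N (m + z N / Num.sqrt N%:R) @[N --> \oo] --> g w} ->
  zeta @ \oo --> L ->
  config_avg N (fun y => G N y *
    expR (N%:R * (b * y ^+ p + h * y - cw_H b h p m) +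
      u * (Num.sqrt N%:R * (y ^+ p - m ^+ p) - zeta N))) @[N --> \oo] -->
  kappa * \int[mu]_w (g w *
    expR (cw_ddH b p m / 2 * w ^+ 2 + u * (p%:R * m ^+ p.-1 * w - L))).
Proof.
move=> m1 dH0 c0 gap.
have [kappa kappa0 laplace] := laplace_config_avg m m1.
exists kappa => // G g B zeta L u GB mg Gg zetaL.
have [M [_ zetaM]] := cvg_seq_bounded (cvgP _ zetaL).
have {}zetaM N : `|zeta N| <= M + 1 by apply: zetaM => //; rewrite ltrDl.
have B0 : 0 <= B by exact: le_trans (GB 0%N 0).
(* The square comes from |u| p s <= (|u| p)^2 / (2 c) + c s^2 / 2, the other term from the bound on
   [zeta]. *)
pose C := B * expR ((`|u| * p%:R) ^+ 2 / (2 * c) + `|u| * (M + 1)).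
have c20 : 0 < c / 2 by rewrite divr_gt0.
apply: (laplace _ (fun w => g w *
    expR (cw_ddH b p m / 2 * w ^+ 2 + u * (p%:R * m ^+ p.-1 * w - L))) C _ c20 _ _ _).2.
- move=> N x N0 x1; rewrite normrM (ger0_norm (expR_ge0 _)) /C -mulrA -expRD.
  apply: ler_pM; rewrite ?expR_ge0// ler_expR.
  pose s := Num.sqrt N%:R * `|x - m|.
  have s2 : s ^+ 2 = N%:R * (x - m) ^+ 2.
    by rewrite /s exprMn sqr_sqrtr// real_normK ?num_real.
  have xp : `|Num.sqrt N%:R * (x ^+ p - m ^+ p)| <= p%:R * s.
    rewrite normrM ger0_norm ?sqrtr_ge0// /s mulrCA ler_wpM2l ?sqrtr_ge0//.
    by apply: ler_norm_expB; rewrite ler_norml; lra.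
  have h1 : u * (Num.sqrt N%:R * (x ^+ p - m ^+ p) - zeta N) <=
      `|u| * (p%:R * s + (M + 1)).
    apply: le_trans (ler_norm _) _; rewrite normrM ler_wpM2l//.
    by rewrite (le_trans (ler_normB _ _))// lerD.
  have h2 : N%:R * (b * x ^+ p + h * x - cw_H b h p m) <=
      N%:R * cw_entropy x - c * s ^+ 2.
    have -> : b * x ^+ p + h * x - cw_H b h p m =
      cw_entropy x + (cw_H b h p x - cw_H b h p m) by rewrite /cw_H; ring.
    rewrite mulrDr lerD2l s2 -mulNr mulrCA ler_wpM2l//; exact: gap.
  have h3 : `|u| * p%:R * s <= (`|u| * p%:R) ^+ 2 / (2 * c) + c / 2 * s ^+ 2.
    rewrite -subr_ge0 [leRHS](_ : _ = (`|u| * p%:R - c * s) ^+ 2 / (2 * c)).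
      by rewrite divr_ge0 ?sqr_ge0// mulr_ge0// ltW.
    by field; rewrite gt_eqF.
  rewrite -(mulrA (c / 2)) -s2; lra.
- apply: measurable_funM => //; apply: measurableT_comp => //.
  apply: measurable_funD; apply: measurable_funM => //.
  by apply: measurable_funB => //; exact: measurable_funM.
- move: Gg => [A [mA A0 sA]]; exists A; split => //.
  apply: subset_trans sA => w; apply: contra_not => Pw z zw.
  have lim : G N (m + z N / Num.sqrt N%:R) *
    expR (N%:R * (cw_H b h p (m + z N / Num.sqrt N%:R) - cw_H b h p m) +
     u * (Num.sqrt N%:R * ((m + z N / Num.sqrt N%:R) ^+ p - m ^+ p) - zeta N)) @[N --> \oo]
    --> g w * expR (cw_ddH b p m / 2 * w ^+ 2 + u * (p%:R * m ^+ p.-1 * w - L)).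
    apply: cvgM; first exact: Pw.
    apply: continuous_cvg; first exact: continuous_expR.
    apply: cvgD; first exact: cvg_cw_H.
    by apply: cvgMr; apply: cvgB => //; exact: cvg_expB.
  move: lim; apply: cvg_trans; apply: near_eq_cvg; near=> N.
  rewrite /= -[RHS]mulrA -expRD; congr (_ * expR _).
  by rewrite /cw_H; ring.
Unshelve. all: end_near. Qed.

Lemma lee_sqrt_scale (r u x : R) (X : \bar R) : 0 < r ->
  ((x + u / r)%:E <= X)%E -> (u%:E <= r%:E * (X - x%:E))%E.
Proof.
move=> r0; case: X => [y| |]; rewrite ?lee_fin// => xy.
  rewrite -?EFinB -?EFinM ?lee_fin mulrC -ler_pdivrMr//; lra.
by rewrite addye// gt0_muley ?lte_fin// leey.
Qed.

Lemma gee_sqrt_scale (r u x : R) (X : \bar R) : 0 < r ->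
  (X <= (x + u / r)%:E)%E -> (r%:E * (X - x%:E) <= u%:E)%E.
Proof.
move=> r0; case: X => [y| |]; rewrite ?lee_fin// => xy.
  rewrite -?EFinB -?EFinM ?lee_fin mulrC -ler_pdivlMr//; lra.
by rewrite addNye gt0_muleNy ?lte_fin// leNye.
Qed.

(** A deterministic limit: values of the inverse likelihood at b + u / sqrt N are compared for u at
    the vertex u0 of the limiting parabola and at u0 - e or u0 + e, which traps the rescaled
    estimate. *)
Lemma cvg_mle_of b h p m c : -1 < m < 1 -> cw_dH b h p m = 0 -> 0 < c ->
  (forall x : R, -1 <= x <= 1 ->
    cw_H b h p x - cw_H b h p m <= - c * (x - m) ^+ 2) ->
  cw_ddH b p m < 0 -> (0 < p)%N -> m != 0 -> forall (z : nat -> R) (w : R),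
  z @ \oo --> w ->
  ((Num.sqrt N%:R)%:E * (mle_of h p N (m + z N / Num.sqrt N%:R) - b%:E))%E
    @[N --> \oo] --> (w * - cw_ddH b p m / (p%:R * m ^+ p.-1))%:E.
Proof.
move=> m1 dH0 c0 gap ddH p0 mn0 z w zw.
have [kappa kappa0 laplace] := laplace_tilt b h p m c m1 dH0 c0 gap.
pose a : R := p%:R * m ^+ p.-1.
have an0 : a != 0 by rewrite mulf_neq0 ?expf_neq0// pnatr_eq0 -lt0n.
pose v : R := (- cw_ddH b p m)^-1.
have v0 : 0 < v by rewrite invr_gt0 oppr_gt0.
pose x N := m + z N / Num.sqrt N%:R.
pose zeta N := Num.sqrt N%:R * (x N ^+ p - m ^+ p).
have zetaL : zeta @ \oo --> a * w by exact: cvg_expB.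
pose r u N := config_avg N (fun y => 1 * expR
   (N%:R * (b * y ^+ p + h * y - cw_H b h p m) +
      u * (Num.sqrt N%:R * (y ^+ p - m ^+ p) - zeta N))).
pose S : R := Num.sqrt (v * pi *+ 2).
have S0 : 0 < S by rewrite sqrtr_gt0 pmulrn_lgt0// mulr_gt0// pi_gt0.
have rlim u : r u @ \oo --> kappa * (S * expR (u ^+ 2 * a ^+ 2 * v / 2 - u * a * w)).
  have := laplace (fun _ _ => 1) (fun=> 1) 1 zeta (a * w) u.
  have -> : (fun y : R => 1 * expR (cw_ddH b p m / 2 * y ^+ 2 +
       u * (p%:R * m ^+ p.-1 * y - a * w))) =
      (fun y => expR (- (u * a * w)) * expR (- (y ^+ 2 / (2 * v)) + u * a * y)).
    apply/funext => y; rewrite mul1r -expRD -/a; congr expR.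
    by rewrite /v; field; rewrite ?oppr_eq0 lt_eqF.
  rewrite RintegralZl//; last exact: integrable_gauss_tilt.
  rewrite Rintegral_gauss_tilt// -/S [X in kappa * X]mulrCA -expRD.
  have -> : - (u * a * w) + (u * a) ^+ 2 * v / 2 = u ^+ 2 * a ^+ 2 * v / 2 - u * a * w by ring.
  apply => //.
  - by move=> *; rewrite normr1.
  - by apply: aeW => y t _; exact: cvg_cst.
(* The factor in front does not depend on u, so comparisons may be made on r. *)
have rE u N : (0 < N)%N -> inv_likelihood h p N (x N) (b + u / Num.sqrt N%:R) =
    expR (N%:R * (cw_H b h p m - b * x N ^+ p - h * x N)) * r u N.
  move=> N0; have N0' : 0 < N%:R :> R by rewrite ltr0n.
  rewrite /r -config_avgZ; congr config_avg; apply/funext => y.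
  rewrite mul1r -expRD; congr expR; rewrite /zeta.
  have /eqP : Num.sqrt N%:R ^+ 2 = N%:R :> R by rewrite sqr_sqrtr.
  have : 0 < Num.sqrt N%:R :> R by rewrite sqrtr_gt0.
  move: (Num.sqrt _) => t t0 /eqP <-.
  by field; rewrite gt_eqF.
have rlt u u' : u ^+ 2 * a ^+ 2 * v / 2 - u * a * w <
     u' ^+ 2 * a ^+ 2 * v / 2 - u' * a * w ->
   \forall N \near \oo, (0 < N)%N /\
     inv_likelihood h p N (x N) (b + u / Num.sqrt N%:R) <
     inv_likelihood h p N (x N) (b + u' / Num.sqrt N%:R).
  set e1 := (X in X < _); set e2 := (X in _ < X) => e12.
  pose d := kappa * (S * expR ((e1 + e2) / 2)).
  have e1d : kappa * (S * expR e1) < d.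
    by rewrite /d !ltr_pM2l// ltr_expR; lra.
  have de2 : d < kappa * (S * expR e2).
    by rewrite /d !ltr_pM2l// ltr_expR; lra.
  near=> N; have N0 : (0 < N)%N by near: N; exact: nbhs_infty_gt.
  split=> //; rewrite !rE// ltr_pM2l ?expR_gt0//.
  apply: (@lt_trans _ _ d); near: N.
    exact: cvgr_lt _ (rlim u) _ e1d.
  exact: cvgr_gt _ (rlim u') _ de2.
(* In the limit the inverse likelihood is, up to a factor, the exponential of a
   parabola in [u] with vertex [u0]. *)
pose u0 := w / (a * v).
have quad u : u != u0 -> u0 ^+ 2 * a ^+ 2 * v / 2 - u0 * a * w <
     u ^+ 2 * a ^+ 2 * v / 2 - u * a * w.
  move=> uu0; rewrite -subr_gt0.
  rewrite [ltRHS](_ : _ = a ^+ 2 * v / 2 * (u - u0) ^+ 2); last first.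
    by rewrite /u0; field; rewrite an0 gt_eqF.
  have d0 : 0 < (u - u0) ^+ 2 by rewrite exprn_even_gt0//= subr_eq0.
  have a0 : 0 < a ^+ 2 by rewrite exprn_even_gt0.
  by rewrite mulr_gt0// divr_gt0// mulr_gt0.
have -> : w * - cw_ddH b p m / (p%:R * m ^+ p.-1) = u0.
  by rewrite -/a /u0 /v; field; rewrite ?oppr_eq0 ?an0 ?(lt_eqF ddH).
apply: cvge_between => e e0; near=> N.
have sN : (0 < N)%N -> 0 < Num.sqrt N%:R :> R by rewrite sqrtr_gt0 ltr0n.
split.
- have [N0 lt] : (0 < N)%N /\
     inv_likelihood h p N (x N) (b + u0 / Num.sqrt N%:R) <
     inv_likelihood h p N (x N) (b + (u0 - e) / Num.sqrt N%:R).
    by near: N; apply: rlt; apply: quad; rewrite lt_eqF//; lra.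
  apply: lee_sqrt_scale; first exact: sN.
  apply: mle_of_ge lt; rewrite ltrD2l ltr_pM2r ?invr_gt0 ?sN//; lra.
- have [N0 lt] : (0 < N)%N /\
     inv_likelihood h p N (x N) (b + u0 / Num.sqrt N%:R) <
     inv_likelihood h p N (x N) (b + (u0 + e) / Num.sqrt N%:R).
    by near: N; apply: rlt; apply: quad; rewrite gt_eqF//; lra.
  apply: gee_sqrt_scale; first exact: sN.
  apply: mle_of_le lt; rewrite ltrD2l ltr_pM2r ?invr_gt0 ?sN//; lra.
Unshelve. all: end_near. Qed.

End tilted_laplace.

(** * Integration against normal laws *)

Section normal_integrals.
Context {R : realType}.
Notation mu := (@lebesgue_measure R).
Local Open Scope ereal_scope.

Import HBNNSimple.

(** Integration against a density, on simple functions, where it is the definition of [normal_prob]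
    on each level set. Monotone convergence and the splitting into positive and negative parts
    extend it below. *)
Lemma integral_normal_prob_nnsfun (m s : R) (f : {nnsfun R >-> R}) :
  \int[normal_prob m s]_x (f x)%:E = \int[mu]_x ((f x)%:E * (normal_pdf m s x)%:E).
Proof.
have mpdf := @measurable_normal_pdf R m s.
have mf r : measurable_fun setT (fun x => (r * \1_(f @^-1` [set r]) x)%R : R).
  by apply: measurable_funM.
under [LHS]eq_integral do rewrite fimfunE -fsumEFin//.
rewrite [LHS]ge0_integral_fsum//; last 2 first.
  - by move=> r; apply/measurable_EFinP; exact: mf.
  - by move=> n x _; rewrite EFinM nnfun_muleindic_ge0.
under [RHS]eq_integral.
  move=> x xD; rewrite fimfunE -fsumEFin// muleC ge0_mule_fsumr; last first.
    by move=> r; rewrite EFinM nnfun_muleindic_ge0.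
  over.
rewrite [RHS]ge0_integral_fsum//; last 2 first.
  - move=> r; apply: emeasurable_funM; first exact/measurable_EFinP.
    by apply/measurable_EFinP; exact: mf.
  - move=> n x _; apply: mule_ge0; first by rewrite lee_fin normal_pdf_ge0.
    by rewrite EFinM nnfun_muleindic_ge0.
apply: eq_fsbigr => r _.
have mfr : measurable (f @^-1` [set r]) by exact: measurable_funPTI.
have [r0|r0] := leP 0%R r; last first.
  rewrite preimage_nnfun0// !integral0_eq// => x _.
    by rewrite indicE in_set0 mulr0 mule0.
  by rewrite indicE in_set0 mulr0.
under [LHS]eq_integral do rewrite EFinM.
under [RHS]eq_integral do rewrite EFinM muleCA.
have m1 : measurable_fun setT (fun x => (\1_(f @^-1` [set r]) x)%:E : \bar R).
  exact/measurable_EFinP.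
rewrite [LHS]ge0_integralZl//.
rewrite [RHS]ge0_integralZl//; last 2 first.
- by apply: emeasurable_funM => //; exact/measurable_EFinP.
- by move=> x _; rewrite mule_ge0// lee_fin normal_pdf_ge0.
rewrite integral_indic// setIT [X in r%:E * X]integral_mkcond.
congr (_ * _); apply: eq_integral => x _.
by rewrite patchE indicE; case: ifP => xr; rewrite ?xr ?mule1 ?mule0.
Qed.

Lemma ge0_integral_normal_prob (m s : R) (f : R -> \bar R) :
  measurable_fun setT f -> (forall x, 0 <= f x) ->
  \int[normal_prob m s]_x f x = \int[mu]_x (f x * (normal_pdf m s x)%:E).
Proof.
move=> mf f0; have mpdf := @measurable_normal_pdf R m s.
pose f_ := nnsfun_approx measurableT mf.
have ndf x a b : (a <= b)%N -> (f_ a x <= f_ b x)%R.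
  by move=> /(nd_nnsfun_approx measurableT mf)/lefP; exact.
have mfp n : measurable_fun setT (fun x => (f_ n x)%:E * (normal_pdf m s x)%:E).
  by apply: emeasurable_funM; apply/measurable_EFinP => //.
transitivity (lim (\int[normal_prob m s]_x (f_ n x)%:E @[n --> \oo])).
  rewrite -monotone_convergence//=.
  - apply: eq_integral => ? /[!inE] xD; apply/esym/cvg_lim => //=.
    exact: cvg_nnsfun_approx.
  - move=> n; apply/measurable_EFinP. exact: (measurable_funPT (f_ n)).
  - by move=> n ? _; rewrite lee_fin.
  - by move=> ? _ ? ? mn; rewrite lee_fin; exact: ndf.
transitivity (lim (\int[mu]_x ((f_ n x)%:E * (normal_pdf m s x)%:E) @[n --> \oo])).
  by apply: congr_lim; apply/funext => n; exact: integral_normal_prob_nnsfun.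
rewrite -monotone_convergence//=.
- apply: eq_integral => x /[!inE] xD; apply/cvg_lim => //=.
  apply: cvgeZr => //.
  exact: cvg_nnsfun_approx.
- by move=> n x _; rewrite mule_ge0// lee_fin// normal_pdf_ge0.
- move=> x _ a b ab; rewrite lee_wpmul2r ?lee_fin ?normal_pdf_ge0//.
  exact: ndf.
Qed.

Lemma integrable_normal_prob (m s : R) (f : R -> R) : measurable_fun setT f ->
  mu.-integrable setT (fun x => (f x * normal_pdf m s x)%:E) ->
  (normal_prob m s).-integrable setT (EFin \o f).
Proof.
move=> mf /integrableP[_ fi]; apply/integrableP; split; first exact/measurable_EFinP.
rewrite ge0_integral_normal_prob//; last first.
  by apply: measurableT_comp => //; exact/measurable_EFinP.
apply: le_lt_trans fi; rewrite le_eqVlt; apply/orP; left; apply/eqP.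
apply: eq_integral => x _; rewrite /= -EFinM; congr EFin.
by rewrite normrM (ger0_norm (normal_pdf_ge0 _ _ _)).
Qed.

Lemma integral_normal_prob (m s : R) (f : R -> R) : measurable_fun setT f ->
  mu.-integrable setT (fun x => (f x * normal_pdf m s x)%:E) ->
  \int[normal_prob m s]_x (f x)%:E = \int[mu]_x (f x * normal_pdf m s x)%:E.
Proof.
move=> mf fi; have mf' : measurable_fun setT (EFin \o f) by exact/measurable_EFinP.
have pos : \int[normal_prob m s]_x ((EFin \o f)^\+ x) =
    \int[mu]_x (fun x => (f x * normal_pdf m s x)%:E)^\+ x.
  rewrite ge0_integral_normal_prob//; last exact: measurable_funepos.
  apply: eq_integral => x _; rewrite !funeposE /= -!EFin_max -EFinM; congr EFin.
  by rewrite maxr_pMl ?normal_pdf_ge0// mul0r.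
have neg : \int[normal_prob m s]_x ((EFin \o f)^\- x) =
    \int[mu]_x (fun x => (f x * normal_pdf m s x)%:E)^\- x.
  rewrite ge0_integral_normal_prob//; last exact: measurable_funeneg.
  apply: eq_integral => x _; rewrite !funenegE /= -!EFin_max -EFinM; congr EFin.
  by rewrite maxr_pMl ?normal_pdf_ge0// mul0r mulNr.
by rewrite [LHS]integralE [RHS]integralE -pos -neg.
Qed.

Lemma integral_reflect (f : R -> R) : mu.-integrable setT (EFin \o f) ->
  \int[mu]_x (f (- x)%R)%:E = \int[mu]_x (f x)%:E.
Proof.
move=> fi; have mf : measurable_fun setT (EFin \o f) := measurable_int _ fi.
have push : forall F : R -> \bar R, measurable_fun setT F -> (forall x, 0 <= F x) ->
    \int[mu]_x F (- x)%R = \int[mu]_x F x.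
  move=> F mF F0.
  transitivity (\int[mu]_(x in (-%R : _ -> measurableTypeR R) @^-1` setT)
      (F \o (-%R : _ -> measurableTypeR R)) x).
    by rewrite preimage_setT.
  rewrite -ge0_integral_pushforward//=.
  by apply: eq_measure_integral => //= A mA AS; exact: lebesgue_measureN.
rewrite [LHS]integralE [RHS]integralE; congr (_ - _).
- transitivity (\int[mu]_x (EFin \o f)^\+ (- x)%R).
    by apply: eq_integral => x _; rewrite !funeposE.
  by apply: push; first exact: measurable_funepos.
- transitivity (\int[mu]_x (EFin \o f)^\- (- x)%R).
    by apply: eq_integral => x _; rewrite !funenegE.
  by apply: push; first exact: measurable_funeneg.
Qed.

Local Close Scope ereal_scope.

Lemma normal_pdf0E (v : R) x : 0 < v ->
  normal_pdf 0 (Num.sqrt v) x = (Num.sqrt (v * pi *+ 2))^-1 * expR (- (x ^+ 2 / (2 * v))).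
Proof.
move=> v0; rewrite normal_pdfE ?gt_eqF ?sqrtr_gt0// /normal_peak /normal_fun.
by rewrite sqr_sqrtr ?(ltW v0)// subr0 mulNr -(mulr_natl v).
Qed.

Lemma integrable_bounded_normal (m s : R) (f : R -> R) (B : R) :
  measurable_fun setT f -> (forall x, `|f x| <= B) ->
  mu.-integrable setT (fun x => (f x * normal_pdf m s x)%:E).
Proof.
move=> mf fB; apply: (@le_integrable _ _ _ mu setT measurableT _
    (fun x => B%:E * (normal_pdf m s x)%:E)%E).
- apply/measurable_EFinP; apply: measurable_funM => //; exact: measurable_normal_pdf.
- move=> x _; rewrite -EFinM !abse_EFin lee_fin !normrM ler_wpM2r//.
  by rewrite (le_trans (fB x))// ler_norm.
- by apply: integrableZl => //; exact: integrable_normal_pdf.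
Qed.

(** The law of t X for X of law N(0, v). A reflection reduces to t > 0. The change of variables is
    for nonnegative continuous integrands, so f is first shifted by its bound B, a constant that
    integrates to B on both sides. *)
Lemma integral_normal_scale (v t : R) (f : R -> R) (B : R) : 0 < v -> t != 0 ->
  continuous f -> (forall x, `|f x| <= B) ->
  (\int[mu]_x (f (x * t) * normal_pdf 0 (Num.sqrt v) x)%:E =
   \int[mu]_x (f x * normal_pdf 0 (Num.sqrt (v * t ^+ 2)) x)%:E)%E.
Proof.
move=> v0.
have sv0 : 0 < Num.sqrt v by rewrite sqrtr_gt0.
wlog t0 : t f / 0 < t.
  move=> hpos tn0 cf fB; move: (tn0); rewrite neq_lt => /orP[t0|t0]; last first.
    exact: hpos t f t0 tn0 cf fB.
  have cfN : continuous (fun x => f (- x)).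
    by move=> x; apply: (@continuous_comp _ _ _ -%R f); [exact: oppr_continuous|exact: cf].
  have := hpos (- t) (fun x => f (- x)); rewrite oppr_gt0 oppr_eq0 sqrrN => /(_ t0 tn0 cfN).
  move=> /(_ (fun x => fB (- x))).
  under eq_integral do rewrite mulrN opprK.
  move=> ->.
  set s := Num.sqrt (v * t ^+ 2).
  have pdfN x : normal_pdf 0 s x = normal_pdf 0 s (- x).
    rewrite normal_pdfE /normal_fun ?subr0 ?sqrrN//.
    by rewrite gt_eqF// sqrtr_gt0 mulr_gt0// exprn_even_gt0//= lt_eqF.
  under [LHS]eq_integral do rewrite pdfN.
  rewrite (integral_reflect (fun x => f x * normal_pdf 0 s x))//.
  apply: (@integrable_bounded_normal _ _ _ B) => //.
  exact: continuous_measurable_fun.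
move=> tn0 cf fB.
have vt0 : 0 < v * t ^+ 2 by rewrite mulr_gt0// exprn_gt0.
have pdfE x : normal_pdf 0 (Num.sqrt v) x = normal_pdf 0 (Num.sqrt (v * t ^+ 2)) (x * t) * t.
  rewrite !normal_pdf0E//.
  have -> : v * t ^+ 2 * pi *+ 2 = v * pi *+ 2 * t ^+ 2 by rewrite -mulr_natr; ring.
  rewrite sqrtrM ?mulrn_wge0 ?mulr_ge0 ?pi_ge0 ?(ltW v0)// sqrtr_sqr (gtr0_norm t0).
  rewrite (_ : (x * t) ^+ 2 / (2 * (v * t ^+ 2)) = x ^+ 2 / (2 * v)).
    by field; rewrite ?tn0 gt_eqF// sqrtr_gt0 mulrn_wgt0// mulr_gt0// pi_gt0.
  by field; rewrite tn0 gt_eqF.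
pose s := Num.sqrt (v * t ^+ 2).
have s0 : s != 0 by rewrite gt_eqF// sqrtr_gt0.
have sub (g : R -> R) : continuous g -> (forall x, 0 <= g x) ->
   (\int[mu]_x (g (x * t) * normal_pdf 0 (Num.sqrt v) x)%:E =
    \int[mu]_x (g x * normal_pdf 0 s x)%:E)%E.
  move=> cg g0.
  pose F (x : R) := x * t.
  have F1 : F^`()%classic = cst t.
    apply/funext => x; rewrite /F derive1E.
    have [_ ->] : is_derive x 1 F t.
      by notypeclasses refine (is_derive_eqf _ _ _ _ _ _);
        [rewrite /F; derivef|rewrite /=; ring].
    by [].
  rewrite (@increasing_ge0_integration_by_substitutionT _ F (fun x => g x * normal_pdf 0 s x)).
  - by apply: eq_integral => x _; rewrite pdfE F1 !fctE mulrA.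
  - by move=> x y xy; rewrite /F ltr_pM2r.
  - by rewrite F1 => x; exact: cvg_cst.
  - by rewrite F1; exact: is_cvg_cst.
  - by rewrite F1; exact: is_cvg_cst.
  - move=> x; have [] : is_derive x 1 F t.
      by notypeclasses refine (is_derive_eqf _ _ _ _ _ _);
        [rewrite /F; derivef|rewrite /=; ring].
    by [].
  - exact/gt0_cvgMlNy/cvg_id.
  - exact/gt0_cvgMly/cvg_id.
  - by move=> x; apply: cvgM; [exact: cg|exact: continuous_normal_pdf].
  - by move=> x; rewrite mulr_ge0// normal_pdf_ge0.
have B0 : 0 <= B by exact: le_trans (fB 0).
have cfB : continuous (fun x => f x + B).
  by move=> x; apply: cvgD; [exact: cf|exact: cvg_cst].
have mf : measurable_fun setT f by exact: continuous_measurable_fun.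
have split_ (g : R -> R) (s' : R) : measurable_fun setT g -> (forall x, `|g x| <= B) ->
   (\int[mu]_x (g x * normal_pdf 0 s' x)%:E =
   \int[mu]_x ((g x + B) * normal_pdf 0 s' x)%:E - B%:E)%E.
  move=> mg gB.
  under [in RHS]eq_integral do rewrite mulrDl EFinD EFinM [in X in (_ + X)%E]EFinM -EFinM.
  rewrite integralD//.
  - by rewrite integralZl// ?integral_normal_pdf ?mule1 ?addeK//; exact: integrable_normal_pdf.
  - exact: integrable_bounded_normal gB.
  - by apply: integrableZl => //; exact: integrable_normal_pdf.
have mft : measurable_fun setT (fun x : R => f (x * t)).
  by apply: measurableT_comp => //; exact: measurable_funM.
have fB0 (x : R) : 0 <= f x + B by have := fB x; rewrite ler_norml => /andP[? _]; lra.
rewrite (split_ _ _ mft (fun x => fB (x * t))) (split_ _ s mf fB).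
by rewrite (sub _ cfB fB0).
Qed.

End normal_integrals.

(** * Limits of expectations under the model *)

Section expectation_limits.
Context {R : realType}.
Notation mu := (@lebesgue_measure R).
Implicit Types (b h m : R) (p N : nat).

Lemma sum_cw_prob b h p N (F : R -> R) :
  \sum_(s : config N) cw_prob b h p s * F (magnetization s) =
  config_avg N (fun y => F y * expR (N%:R * (b * y ^+ p + h * y))) /
  config_avg N (fun y => expR (N%:R * (b * y ^+ p + h * y))).
Proof.
rewrite -cw_partitionE /cw_prob /config_avg /cw_weight.
have Z0 : cw_partition b h p N != 0.
  by rewrite cw_partitionE gt_eqF// config_avg_gt0// => y; exact: expR_gt0.
rewrite [RHS]mulrAC mulr_sumr; apply: eq_bigr => s _.
by rewrite invfM; ring.
Qed.

(** A quotient of two Laplace limits with the same constant, which cancels. The convergence is asked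
    for almost every w and g need not be continuous: for m = 0 the limit of the estimate jumps. *)
Lemma cvg_expectation b h p m c : -1 < m < 1 -> cw_dH b h p m = 0 -> 0 < c ->
  (forall x : R, -1 <= x <= 1 ->
    cw_H b h p x - cw_H b h p m <= - c * (x - m) ^+ 2) ->
  cw_ddH b p m < 0 ->
  forall (F : nat -> R -> R) (g : R -> R) (B : R),
  (forall N y, `|F N y| <= B) -> (forall w, `|g w| <= B) -> measurable_fun setT g ->
  {ae mu, forall w, forall z : nat -> R, z @ \oo --> w ->
    F N (m + z N / Num.sqrt N%:R) @[N --> \oo] --> g w} ->
  (\sum_(s : config N) cw_prob b h p s * F N (magnetization s))%:E @[N --> \oo] -->
  (\int[mu]_w (g w * normal_pdf 0 (Num.sqrt (- cw_ddH b p m)^-1) w)%:E)%E.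
Proof.
move=> m1 dH0 c0 gap ddH F g B FB gB mg Fg.
have [kappa kappa0 laplace] := laplace_tilt b h p m c m1 dH0 c0 gap.
pose v : R := (- cw_ddH b p m)^-1.
have v0 : 0 < v by rewrite invr_gt0 oppr_gt0.
pose S : R := Num.sqrt (v * pi *+ 2).
have S0 : 0 < S by rewrite sqrtr_gt0 pmulrn_lgt0// mulr_gt0// pi_gt0.
have zeta0 : (fun=> 0 : R) @ \oo --> (0 : R) by exact: cvg_cst.
pose E N y : R := expR (N%:R * (b * y ^+ p + h * y - cw_H b h p m) +
      0 * (Num.sqrt N%:R * (y ^+ p - m ^+ p) - 0)).
have gE w : expR (cw_ddH b p m / 2 * w ^+ 2 + 0 * (p%:R * m ^+ p.-1 * w - 0)) =
     S * normal_pdf 0 (Num.sqrt v) w.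
  rewrite normal_pdf0E// -/S mulVKf ?gt_eqF//; congr expR.
  by rewrite /v; field; rewrite ?oppr_eq0 lt_eqF.
have ig : mu.-integrable setT (fun w => (g w * normal_pdf 0 (Num.sqrt v) w)%:E).
  exact: integrable_bounded_normal gB.
have num : config_avg N (fun y => F N y * E N y) @[N --> \oo] -->
    kappa * (S * \int[mu]_w (g w * normal_pdf 0 (Num.sqrt v) w)).
  have := laplace F g B (fun=> 0) 0 0 FB mg Fg zeta0.
  under eq_Rintegral do rewrite gE mulrCA.
  by rewrite RintegralZl.
have den : config_avg N (E N) @[N --> \oo] --> kappa * S.
  pose G1 (N : nat) (y : R) : R := 1.
  have G1B N y : `|G1 N y| <= 1 by rewrite normr1.
  have G1g : {ae mu, forall w, forall z : nat -> R, z @ \oo --> w ->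
      G1 N (m + z N / Num.sqrt N%:R) @[N --> \oo] --> (cst 1 : R -> R) w}.
    by apply: aeW => w z _; exact: cvg_cst.
  have := laplace G1 (cst 1) 1 (fun=> 0) 0 0 G1B (measurable_cst _) G1g zeta0.
  under eq_Rintegral do rewrite gE mul1r.
  rewrite RintegralZl//; last exact: integrable_normal_pdf.
  rewrite [X in S * X]/Rintegral integral_normal_pdf mulr1.
  have EG : E = (fun N y => G1 N y * E N y).
    by apply/funext => N; apply/funext => y; rewrite mul1r.
  by rewrite [in X in _ -> X]EG.
have kS0 : kappa * S != 0 by rewrite mulf_neq0 ?gt_eqF.
have quot : config_avg N (fun y => F N y * E N y) / config_avg N (E N) @[N --> \oo] -->
    \int[mu]_w (g w * normal_pdf 0 (Num.sqrt v) w).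
  rewrite [X in _ --> X](_ : _ = kappa * (S * \int[mu]_w (g w *
      normal_pdf 0 (Num.sqrt v) w)) / (kappa * S)).
    by apply: cvgM num _; exact: cvgV.
  by rewrite mulrA mulrAC divff// mul1r.
have -> : (\int[mu]_w (g w * normal_pdf 0 (Num.sqrt v) w)%:E =
    (\int[mu]_w (g w * normal_pdf 0 (Num.sqrt v) w))%:E)%E.
  by rewrite /Rintegral fineK//; exact: integrable_fin_num ig.
apply: cvg_EFin; first exact: nearW.
move: quot; apply: cvg_trans; apply: near_eq_cvg; near=> N.
rewrite /= sum_cw_prob.
have EE y : E N y = expR (- (N%:R * cw_H b h p m)) * expR (N%:R * (b * y ^+ p + h * y)).
  by rewrite -expRD; congr expR; ring.
have -> : (fun y => F N y * E N y) = (fun y => expR (- (N%:R * cw_H b h p m)) *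
    (F N y * expR (N%:R * (b * y ^+ p + h * y)))).
  by apply/funext => y; rewrite EE mulrCA.
rewrite (_ : E N = (fun y => expR (- (N%:R * cw_H b h p m)) *
    expR (N%:R * (b * y ^+ p + h * y)))); last by apply/funext => y; rewrite EE.
by rewrite !config_avgZ invfM mulrACA divff ?mul1r ?gt_eqF ?expR_gt0.
Unshelve. all: end_near. Qed.

Lemma continuous_EFin : continuous (@EFin R).
Proof. by move=> x; apply: cvg_EFin; [exact: nearW|exact: cvg_id]. Qed.

(** A measurable set of extended reals is the image of a measurable set of reals together with some
    of the two infinities, so continuity is used at finite points only. *)
Lemma measurable_continuous_ereal (f : \bar R -> R) : continuous f ->
  measurable_fun setT f.
Proof.
move=> cf _ Y mY; rewrite setTI.
have mfE : measurable ((f \o EFin) @^-1` Y).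
  rewrite -[X in measurable X]setTI; apply: continuous_measurable_fun => //.
  by move=> x; apply: continuous_comp; [exact: continuous_EFin|exact: cf].
exists ((f \o EFin) @^-1` Y) => //.
exists (f @^-1` Y `&` [set -oo; +oo]%E).
  by apply/ps_inftyP; exact: subIsetr.
apply/seteqP; split => [x [[y fy <-]//|[]//]|[x| |] fx].
- by left; exists x.
- by right; split => //; right.
- by right; split => //; left.
Qed.

Lemma integral_normal_law (v : R) (f : \bar R -> R) (B : R) : 0 < v ->
  continuous f -> (forall x, `|f x| <= B) ->
  (\int[normal_law v]_x (f x)%:E =
   \int[mu]_x (f x%:E * normal_pdf 0 (Num.sqrt v) x)%:E)%E.
Proof.
move=> v0 cf fB; have mf := measurable_continuous_ereal f cf.
have mfE : measurable_fun setT (f \o EFin).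
  apply: continuous_measurable_fun => x.
  by apply: continuous_comp; [exact: continuous_EFin|exact: cf].
have ip : mu.-integrable setT (fun x => ((f \o EFin) x * normal_pdf 0 (Num.sqrt v) x)%:E).
  exact: (integrable_bounded_normal 0 _ (f \o EFin) B mfE (fun x => fB x%:E)).
rewrite /normal_law integral_distribution.
- exact: (integral_normal_prob 0 (Num.sqrt v) (f \o EFin)).
- exact/measurable_EFinP.
- exact: (integrable_normal_prob 0 (Num.sqrt v) (f \o EFin)).
Qed.

Theorem mle_clt b h p m : (0 < p)%N -> -1 < m < 1 -> m != 0 -> cw_ddH b p m < 0 ->
  cw_maximizers b h p = [set m] ->
  cvg_in_law (@cw_prob R b h p)
    (fun N s => ((Num.sqrt N%:R)%:E * (mle h p s - b%:E))%E)
    (normal_law (- cw_ddH b p m / (p%:R ^+ 2 * m ^+ (2 * p - 2)))).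
Proof.
move=> p0 m1 mn0 ddH hm f cf fbnd.
have [_ mmax] : cw_maximizers b h p m by rewrite hm.
have dH0 : cw_dH b h p m = 0.
  by apply: cw_dH_max => // x x1; apply: mmax; rewrite in_itv.
have [c c0 gap] := cw_H_gap b h p m m1 ddH hm.
have [B fB] : exists B, forall x, `|f x| <= B.
  have [M [_ Mf]] := fbnd; exists (M + 1) => x.
  by apply: Mf => //; rewrite ltrDl.
(* The rescaled estimate tends to t w, and w has law N(0, v), whence the variance v t^2. *)
pose t : R := - cw_ddH b p m / (p%:R * m ^+ p.-1).
have pm0 : p%:R * m ^+ p.-1 != 0 by rewrite mulf_neq0 ?expf_neq0// pnatr_eq0 -lt0n.
have t0 : t != 0 by apply: mulf_neq0; rewrite ?invr_eq0 ?pm0 ?oppr_eq0 ?(lt_eqF ddH).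
pose v : R := (- cw_ddH b p m)^-1.
have v0 : 0 < v by rewrite invr_gt0 oppr_gt0.
have -> : - cw_ddH b p m / (p%:R ^+ 2 * m ^+ (2 * p - 2)) = v * t ^+ 2.
  rewrite /t expr_div_n exprMn -exprM (_ : (p.-1 * 2 = 2 * p - 2)%N); last first.
    by rewrite -subn1 mulnBl mul1n mulnC.
  rewrite expr2 !mulrA mulVf ?mul1r//.
  by rewrite oppr_eq0 lt_eqF.
have vt0 : 0 < v * t ^+ 2 by rewrite mulr_gt0// exprn_even_gt0.
rewrite (integral_normal_law _ _ B)//.
have cfE : continuous (f \o EFin).
  by move=> x; apply: continuous_comp; [exact: continuous_EFin|exact: cf].
rewrite -(integral_normal_scale v t (f \o EFin) B v0 t0 cfE (fun x => fB x%:E)).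
apply: (cvg_expectation b h p m c m1 dH0 c0 gap ddH
  (fun N y => f ((Num.sqrt N%:R)%:E * (mle_of h p N y - b%:E))%E)
  (fun w => f (w * t)%:E) B).
- by move=> N y; exact: fB.
- by move=> w; exact: fB.
- apply: (@measurableT_comp _ _ _ _ _ _ (f \o EFin)).
    exact: continuous_measurable_fun.
  exact: measurable_funM.
- apply: aeW => w z zw; apply: (cvg_comp _ f); last exact: cf.
  by rewrite /t mulrA; apply: (cvg_mle_of b h p m c).
Qed.

End expectation_limits.

(** * Zero magnetization *)

Section critical_coupling.
Context {R : realType}.
Implicit Types (b x : R) (p : nat).

Definition beta_tilde_set p : set R :=
  [set b | 0 <= b /\ sup (cw_H b 0 p @` `[-1, 1]) = 0].

Lemma cw_H0 b p : (0 < p)%N -> cw_H b 0 p 0 = 0.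
Proof. by move=> p0; rewrite /cw_H cw_entropy0 expr0n gtn_eqF// !mulr0 addr0 subr0. Qed.

Lemma cw_entropy_ge0 x : -1 <= x <= 1 -> 0 <= cw_entropy x.
Proof.
by move=> x1; rewrite (le_trans _ (cw_entropy_ge x x1))// divr_ge0// sqr_ge0.
Qed.

Lemma ler_mulX_abs b p x : b * x ^+ p <= `|b| * `|x| ^+ p.
Proof. by rewrite -normrX -normrM ler_norm. Qed.

(** The value at 0 is 0, so the supremum is 0 exactly when no value is positive. *)
Lemma beta_tilde_setP b p : (0 < p)%N -> 0 <= b ->
  beta_tilde_set p b <-> forall x, -1 <= x <= 1 -> cw_H b 0 p x <= 0.
Proof.
move=> p0 b0; set A := cw_H b 0 p @` `[-1, 1].
have A0 : A 0 by exists 0; [rewrite /= in_itv/=; lra|exact: cw_H0].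
(* Boundedness matters: [sup] is 0 by default on a set without a supremum. *)
have Aub : ubound A b.
  move=> _ [x /= + <-]; rewrite in_itv/= => x1.
  rewrite /cw_H mul0r addr0 lerBlDr ler_wpDr ?cw_entropy_ge0//.
  rewrite (le_trans (ler_mulX_abs _ _ _))// ger0_norm// ler_piMr//.
  by rewrite exprn_ile1// ler_norml.
have hsA : has_sup A by split; [exists 0|exists b].
split=> [[_ supA] x x1|Hb].
  by rewrite -[leRHS]supA; apply: sup_upper_bound => //; exists x => //=; rewrite ?in_itv.
split=> //; apply/eqP; rewrite eq_le; apply/andP; split.
  by apply: ge_sup; [exists 0|move=> _ [x /= + <-]; rewrite in_itv/= => x1; exact: Hb].
exact: sup_upper_bound.
Qed.

Lemma has_sup_beta_tilde_set p : (0 < p)%N -> has_sup (@beta_tilde_set p).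
Proof.
move=> p0; split.
  exists 0; apply/beta_tilde_setP => // x x1.
  by rewrite /cw_H !mul0r addr0 sub0r oppr_le0 cw_entropy_ge0.
exists (cw_entropy 1) => b bB; have b0 : 0 <= b by case: bB.
have h1 : -1 <= (1 : R) <= 1 by lra.
have := (beta_tilde_setP _ _ p0 b0).1 bB 1 h1.
by rewrite /cw_H expr1n mulr1 mul0r addr0 subr_le0.
Qed.

Lemma beta_tilde_ge b p : (0 < p)%N -> 0 <= b ->
  (forall x, -1 <= x <= 1 -> cw_H b 0 p x <= 0) -> b <= beta_tilde p.
Proof.
move=> p0 b0 Hb; apply: sup_upper_bound; first exact: has_sup_beta_tilde_set.
exact/beta_tilde_setP.
Qed.

(** The subcritical parameters at h = 0: those for which 0 is a maximizer of H with a quadratic gap.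
    Negative b are included, since the estimate may be negative. *)
Definition quad_gap p b : Prop := exists2 c : R, 0 < c &
  forall x, -1 <= x <= 1 -> b * x ^+ p - cw_entropy x <= - c * x ^+ 2.

(** For b1 in the defining set with |b| < b1, scaling gives |b| |x|^p <= (|b| / b1) I(x). The
    remaining fraction of the entropy is at least a multiple of x^2. *)
Lemma beta_tilde_gap b p : (0 < p)%N -> `|b| < beta_tilde p -> quad_gap p b.
Proof.
move=> p0 bb; have [b1 b1B bb1] := sup_gt (has_sup_beta_tilde_set p p0).1 bb.
have b10 : 0 <= b1 by case: b1B.
have b1p : 0 < b1 by rewrite (le_lt_trans _ bb1).
have lam0 : 0 < 1 - `|b| / b1 by rewrite subr_gt0 ltr_pdivrMr// mul1r.
exists ((1 - `|b| / b1) / 2); first by rewrite divr_gt0.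
move=> x x1; have x1' : -1 <= `|x| <= 1.
  by rewrite (le_trans _ (normr_ge0 x)) ?lerN10// ler_norml.
have := (beta_tilde_setP _ _ p0 b10).1 b1B _ x1'; rewrite /cw_H mul0r addr0 subr_le0.
have -> : cw_entropy `|x| = cw_entropy x.
  by have [x0|x0] := leP 0 x; rewrite ?(ger0_norm x0)// (ltr0_norm x0) cw_entropyN.
move=> h; have := cw_entropy_ge x x1; have := ler_mulX_abs b p x.
have : `|b| * `|x| ^+ p <= `|b| / b1 * cw_entropy x.
  rewrite (_ : `|b| * `|x| ^+ p = `|b| / b1 * (b1 * `|x| ^+ p)).
    by rewrite ler_wpM2l// divr_ge0.
  by field; rewrite gt_eqF.
move=> h1 h2 h3.
have : (1 - `|b| / b1) * (x ^+ 2 / 2) <= (1 - `|b| / b1) * cw_entropy x.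
  by rewrite ler_wpM2l// ltW.
set l := `|b| / b1 in h1 *; set I := cw_entropy x in h1 h3 *.
by lra.
Qed.

Lemma even_gap b p : ~~ odd p -> b <= 0 -> quad_gap p b.
Proof.
move=> ep b0; exists 2^-1; first by rewrite invr_gt0.
move=> x x1; have := cw_entropy_ge x x1.
have : b * x ^+ p <= 0 by rewrite mulr_le0_ge0// exprn_even_ge0.
by lra.
Qed.

(** Laplace's method needs an interior point, whereas H may be positive only near 1; continuity
    moves the point inside. It is taken positive by passing to |x|, which does not lower H when b >=
    0 and h = 0. *)
Lemma beta_tilde_lt_pos b p : (0 < p)%N -> beta_tilde p < b ->
  exists x, [/\ 0 < x, x < 1 & 0 < b * x ^+ p - cw_entropy x].
Proof.
move=> p0 bb.
have b0 : 0 <= b.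
  rewrite ltW// (le_lt_trans _ bb)//; apply: beta_tilde_ge => // x x1.
  by rewrite /cw_H !mul0r addr0 sub0r oppr_le0 cw_entropy_ge0.
have [x x1 Hx] : exists2 x : R, -1 <= x <= 1 & 0 < cw_H b 0 p x.
  apply: contrapT => /forall2NP Hb; move: bb; rewrite ltNge => /negP; apply.
  apply: beta_tilde_ge => // x x1; rewrite leNgt; apply/negP => Hx.
  by case: (Hb x).
pose y := `|x|.
have Hy : 0 < cw_H b 0 p y.
  rewrite (lt_le_trans Hx)// /cw_H !mul0r !addr0 lerB//.
    by rewrite (le_trans (ler_mulX_abs _ _ _))// ger0_norm.
  by rewrite /y; have [x0|x0] := leP 0 x; rewrite ?(ger0_norm x0)// (ltr0_norm x0) cw_entropyN.
have y0 : 0 < y.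
  rewrite normr_gt0; apply/negP => /eqP x0.
  by move: Hx; rewrite x0 cw_H0// ltxx.
have y1 : y <= 1 by rewrite /y ler_norml.
have [d /= d0 dH] : exists2 d : R, 0 < d & forall z, `|y - z| < d -> 0 < cw_H b 0 p z.
  have /nbhs_ballP[d /= d0 dH] : \forall t \near y, 0 < cw_H b 0 p t.
    by apply: (cvgr_gt _ (continuous_cw_H b 0 p y)).
  by exists d => // z yz; exact: dH.
(* The factor 1 - e is at least 1/2 and moves y by y e <= e < d. *)
pose e := Num.min d 1 / 2.
have e0 : 0 < e by rewrite divr_gt0// lt_min d0 ltr01.
have e1 : e <= 1 / 2 by rewrite ler_pM2r ?invr_gt0// ge_min lexx orbT.
have ed : e < d.
  have : Num.min d 1 <= d by rewrite ge_min lexx.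
  by rewrite /e; lra.
have ye : y * e <= e by rewrite ler_piMl// ltW.
exists (y * (1 - e)); split.
- by rewrite mulr_gt0//; lra.
- by rewrite (@le_lt_trans _ _ (1 * (1 - e)))// ?ler_pM2r; lra.
have -> : b * (y * (1 - e)) ^+ p - cw_entropy (y * (1 - e)) = cw_H b 0 p (y * (1 - e)).
  by rewrite /cw_H mul0r addr0.
apply: dH; rewrite (_ : y - y * (1 - e) = y * e); last by ring.
have ye0 : 0 < y * e by rewrite mulr_gt0.
by rewrite (gtr0_norm ye0) (le_lt_trans ye ed).
Qed.

(** If m = 0, then H'(0) = h vanishes, and the quadratic gap c at 0 leaves room to raise b to b + c,
    since |x|^p <= x^2; this is why the inequality is strict. Conversely, the gap below [beta_tilde]
    makes 0 a maximizer. *)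
Lemma maximizer0P b h p m : (2 < p)%N -> 0 <= b -> p_regular b h p ->
  cw_maximizers b h p = [set m] -> m = 0 <-> h = 0 /\ b < beta_tilde p.
Proof.
move=> p2 b0 [m' [hm' m'1 H2]] hm; have p0 : (0 < p)%N by exact: ltn_trans p2.
have mm : m' = m by have : [set m'] m by rewrite -hm' hm.
move: m'1 H2; rewrite mm => + H2; rewrite in_itv/= => m1; move: H2.
rewrite cw_H_derive2// => H2.
have [_ mmax] : cw_maximizers b h p m by rewrite hm.
split=> [m0|[h0 bb]].
  have h0 : h = 0.
    have : cw_dH b h p m = 0.
      by apply: cw_dH_max => // x x1; apply: mmax; rewrite in_itv.
    rewrite m0 /cw_dH /cw_dentropy addr0 subr0 subrr mulr0 subr0 expr0n.
    by case: p p2 {hm hm' H2 mmax p0} => [|[|p]]//= _; rewrite !mulr0 add0r.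
  split => //.
  have [c c0 gap] := cw_H_gap b h p m m1 H2 hm.
  rewrite (@lt_le_trans _ _ (b + c))// ?ltrDl//.
  apply: beta_tilde_ge => //; first by rewrite addr_ge0// ltW.
  move=> x x1; have := gap x x1; rewrite h0 m0 cw_H0// !subr0.
  have xp : c * x ^+ p <= c * x ^+ 2.
    rewrite ler_wpM2l ?(ltW c0)// (le_trans (ler_norm _))// normrX.
    rewrite -[leRHS]real_normK ?num_real// ler_wiXn2l//; last exact: ltnW.
    by rewrite ler_norml.
  by rewrite /cw_H; lra.
have : cw_maximizers b h p 0.
  split; first by rewrite in_itv/=; lra.
  move=> x; rewrite in_itv/= h0 cw_H0// => x1.
  have bb' : `|b| < beta_tilde p by rewrite ger0_norm.
  have [c c0 gap] := beta_tilde_gap b p p0 bb'.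
  rewrite /cw_H mul0r addr0 (le_trans (gap x x1))// mulNr oppr_le0.
  by rewrite mulr_ge0 ?sqr_ge0// ltW.
by rewrite hm.
Qed.

End critical_coupling.

Section zero_magnetization.
Context {R : realType}.
Notation mu := (@lebesgue_measure R).
Implicit Types (b x : R) (p N : nat).

Lemma ler_dist_expR (A B : R) :
  `|expR A - expR B| <= `|A - B| * (expR A + expR B).
Proof.
have half (X Y : R) : expR X - expR Y <= `|X - Y| * (expR X + expR Y).
  have : expR X * (1 + (Y - X)) <= expR Y.
    rewrite (_ : expR Y = expR X * expR (Y - X)); last first.
      by rewrite -expRD; congr expR; ring.
    by rewrite ler_wpM2l ?expR_ge0// expR_ge1Dx.
  have : (X - Y) * expR X <= `|X - Y| * expR X by rewrite ler_wpM2r ?expR_ge0// ler_norm.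
  have : 0 <= `|X - Y| * expR Y by rewrite mulr_ge0 ?expR_ge0.
  by rewrite mulrDr; lra.
rewrite ler_norml half andbT lerNl opprB distrC [X in _ * X]addrC.
exact: half.
Qed.

Lemma ler_normX_expR p (a M : R) : 0 < a -> 0 <= M -> exists2 C : R, 0 <= C &
  forall s : R, `|s| ^+ p + M <= C * expR (a * s ^+ 2).
Proof.
move=> a0 M0; have ap0 : 0 < a ^+ p by rewrite exprn_gt0.
exists (1 + p`!%:R / a ^+ p + M).
  by rewrite !addr_ge0// divr_ge0// ltW.
move=> s; have as0 : 0 <= a * s ^+ 2 by rewrite mulr_ge0 ?sqr_ge0// ltW.
have e1 : 1 <= expR (a * s ^+ 2) by rewrite -expR0 ler_expR.
have sp : `|s| ^+ p <= 1 + (s ^+ 2) ^+ p.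
  have [s1|s1] := leP `|s| 1.
    by rewrite (@le_trans _ _ 1) ?exprn_ile1// lerDl exprn_ge0// sqr_ge0.
  have s2 : `|s| <= s ^+ 2.
    by rewrite -[leRHS]real_normK ?num_real// expr2 ler_peMl// ltW.
  by rewrite ler_wpDl// lerXn2r// nnegrE sqr_ge0.
have h2 : (s ^+ 2) ^+ p <= p`!%:R / a ^+ p * expR (a * s ^+ 2).
  rewrite mulrAC ler_pdivlMr// -exprMn (mulrC (s ^+ 2)) [leRHS]mulrC
    -ler_pdivrMr ?ltr0n ?fact_gt0//.
  case: (p) => [|n]; first by rewrite expr0 fact0 divr1.
  by rewrite (le_trans _ (expR_ge1Dxn n as0))// lerDr.
have h3 : M <= M * expR (a * s ^+ 2) by rewrite ler_peMr.
by rewrite !mulrDl mul1r; lra.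
Qed.

(** From 1 + s <= exp s and exp s (1 - s) <= 1, the quotient lies between tau and tau exp (eps
    tau). *)
Lemma cvg_expR_quotient (eps tau : nat -> R) (t : R) :
  (forall N, (0 < N)%N -> 0 < eps N) -> eps @ \oo --> (0 : R) -> tau @ \oo --> t ->
  (expR (eps N * tau N) - 1) / eps N @[N --> \oo] --> t.
Proof.
move=> eps0 epsc tauc.
have up : tau N * expR (eps N * tau N) @[N --> \oo] --> t.
  rewrite -[X in _ --> X]mulr1; apply: cvgM => //.
  rewrite -[X in _ --> X](@expR0 R); apply: continuous_cvg; first exact: continuous_expR.
  by rewrite -[X in _ --> X](mul0r t); exact: cvgM.
apply: (squeeze_cvgr _ tauc up); near=> N.
have e0 : 0 < eps N by apply: eps0; near: N; exact: nbhs_infty_gt.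
apply/andP; split.
  by rewrite ler_pdivlMr// mulrC lerBrDl expR_ge1Dx.
rewrite ler_pdivrMr// lerBlDr.
have : expR (eps N * tau N) * (1 - eps N * tau N) <= 1.
  rewrite -[leRHS](expRxMexpNx_1 (eps N * tau N)) ler_wpM2l ?expR_ge0//.
  exact: expR_ge1Dx.
by lra.
Unshelve. all: end_near. Qed.

Lemma std_normal_pdfE (y : R) :
  normal_pdf 0 1 y = (Num.sqrt (pi *+ 2))^-1 * expR (- (y ^+ 2 / 2)).
Proof. by have := normal_pdf0E 1 y ltr01; rewrite sqrtr1 mul1r mulr1. Qed.

Definition normal_moment p : R := \int[mu]_y (y ^+ p * normal_pdf 0 1 y).

Lemma integrable_normal_moment p :
  mu.-integrable setT (fun y => (y ^+ p * normal_pdf 0 1 y)%:E).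
Proof.
have a0 : 0 < 4^-1 :> R by rewrite invr_gt0.
have [C C0 hC] := ler_normX_expR p 4^-1 0 a0 (lexx _).
have v0 : 0 < 2 :> R by [].
have mx : measurable_fun setT (fun y : R => y ^+ p).
  exact: measurable_funX.
pose k : R := C * (Num.sqrt (pi *+ 2))^-1.
apply: (@le_integrable _ _ _ mu setT measurableT _
    (fun y => k%:E * (expR (- (y ^+ 2 / (2 * 2)) + 0 * y))%:E)%E).
- by apply/measurable_EFinP; apply: measurable_funM => //; exact: measurable_normal_pdf.
- move=> y _; have Si0 : 0 <= (Num.sqrt (pi *+ 2))^-1 :> R by rewrite invr_ge0 sqrtr_ge0.
  have k0 : 0 <= k by rewrite mulr_ge0.
  rewrite -EFinM !abse_EFin lee_fin [leRHS]normrM (ger0_norm k0) (ger0_norm (expR_ge0 _)).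
  rewrite std_normal_pdfE !normrM normrX (ger0_norm (expR_ge0 _)) (ger0_norm Si0).
  have := hC y; rewrite addr0 => hy.
  rewrite mulrCA.
  rewrite [leRHS](_ : _ = (Num.sqrt (pi *+ 2))^-1 *
     (C * expR (- (y ^+ 2 / (2 * 2)) + 0 * y))); last by rewrite /k; ring.
  apply: ler_wpM2l => //.
  apply: le_trans (ler_wpM2r (expR_ge0 _) hy) _.
  rewrite -mulrA -expRD ler_wpM2l// ler_expR; lra.
- by apply: integrableZl => //; exact: integrable_gauss_tilt.
Qed.

(* [N ^ (1 - p / 2)], the size of [N x ^ p] when [x] is of order [N ^ (- 1 / 2)]. *)
Definition moment_scale p N : R := (Num.sqrt N%:R ^+ (p - 2))^-1.

Lemma moment_scale_gt0 p N : (0 < N)%N -> 0 < moment_scale p N.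
Proof. by move=> N0; rewrite invr_gt0 exprn_gt0// sqrtr_gt0 ltr0n. Qed.

Lemma moment_scaleE p N (s : R) : (2 < p)%N -> (0 < N)%N ->
  N%:R * (s / Num.sqrt N%:R) ^+ p = moment_scale p N * s ^+ p.
Proof.
move=> p2 N0; have r0 : 0 < Num.sqrt N%:R :> R by rewrite sqrtr_gt0 ltr0n.
rewrite -{1}(@sqr_sqrtr _ N%:R)// /moment_scale expr_div_n.
rewrite -{2}(subnK (ltnW p2)) exprD.
by field; rewrite expf_neq0// gt_eqF.
Qed.

Lemma moment_scale_le1 p N : (0 < N)%N -> moment_scale p N <= 1.
Proof.
move=> N0; rewrite /moment_scale invf_le1 ?exprn_gt0 ?sqrtr_gt0 ?ltr0n//.
by rewrite exprn_ege1// -[leLHS]sqrtr1 ler_sqrt// ler1n.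
Qed.

Lemma cvg_moment_scale p : (2 < p)%N -> moment_scale p N @[N --> \oo] --> (0 : R).
Proof.
move=> p2; have sq : (Num.sqrt (N%:R : R))^-1 @[N --> \oo] --> (0 : R).
  have -> : (fun N => (Num.sqrt (N%:R : R))^-1) = (fun N => 1 / Num.sqrt N%:R).
    by apply/funext => N; rewrite div1r.
  exact: cvg_divr_sqrt (cvg_cst _).
apply: (squeeze_cvgr _ (cvg_cst 0) sq); near=> N.
have N0 : (0 < N)%N by near: N; exact: nbhs_infty_gt.
have r0 : 0 < Num.sqrt N%:R :> R by rewrite sqrtr_gt0 ltr0n.
rewrite ltW ?moment_scale_gt0//= /moment_scale lef_pV2 ?posrE ?exprn_gt0//.
rewrite -[leLHS]expr1 ler_weXn2l//; last by rewrite subn_gt0.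
by rewrite -[leLHS]sqrtr1 ler_sqrt// ler1n.
Unshelve. all: end_near. Qed.

(** To first order: N x^p is [moment_scale] times z^p, and the normalized difference of the two
    exponentials tends to (b' - b) (y^p - w^p), whose Gaussian mean brings in [normal_moment]. In
    the domination, half of the gap absorbs the power of sqrt N y. *)
Lemma cvg_inv_likelihoodB p b b' : (2 < p)%N -> quad_gap p b -> quad_gap p b' ->
  exists2 kappa : R, 0 < kappa & forall (z : nat -> R) (w : R), z @ \oo --> w ->
  (inv_likelihood 0 p N (0 + z N / Num.sqrt N%:R) b' -
   inv_likelihood 0 p N (0 + z N / Num.sqrt N%:R) b) / moment_scale p N @[N --> \oo] -->
  kappa * ((b' - b) * (normal_moment p - w ^+ p)).
Proof.
move=> p2 [c1 c10 gap1] [c2 c20 gap2].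
have m1 : -1 < (0 : R) < 1 by lra.
have [kappa kappa0 laplace] := laplace_config_avg (0 : R) m1.
pose S : R := Num.sqrt (pi *+ 2).
have S0 : 0 < S by rewrite sqrtr_gt0 pmulrn_lgt0// pi_gt0.
exists (kappa * S); first by rewrite mulr_gt0.
move=> z w zw; pose x N := 0 + z N / Num.sqrt N%:R.
pose c := Num.min c1 c2.
have c0 : 0 < c by rewrite lt_min c10.
pose Phi N y : R := (expR (N%:R * (b' * (y ^+ p - x N ^+ p))) -
  expR (N%:R * (b * (y ^+ p - x N ^+ p)))) / moment_scale p N.
have zp : z N ^+ p @[N --> \oo] --> w ^+ p.
  exact: (cvg_comp z (fun y : R => y ^+ p) zw (@exprn_continuous R p w)).
have [M [_ zM]] := cvg_seq_bounded (cvgP _ zp).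
have {}zM N : `|z N ^+ p| <= M + 1 by apply: zM => //; rewrite ltrDl.
set M1 := M + 1 in zM.
have M10 : 0 <= M1 by exact: le_trans (zM 0%N).
have c20' : 0 < c / 2 by rewrite divr_gt0.
have [C1 C10 hC1] := ler_normX_expR p (c / 2) M1 c20' M10.
have Nxp N : (0 < N)%N -> N%:R * x N ^+ p = moment_scale p N * z N ^+ p.
  by move=> N0; rewrite /x add0r moment_scaleE.
have Nyp N y : (0 < N)%N -> N%:R * y ^+ p = moment_scale p N * (Num.sqrt N%:R * y) ^+ p.
  move=> N0; rewrite -moment_scaleE// mulrAC divff ?mul1r// gt_eqF//.
  by rewrite sqrtr_gt0 ltr0n.
have Ty N y d : (0 < N)%N -> N%:R * (d * (y ^+ p - x N ^+ p)) =
    moment_scale p N * (d * ((Num.sqrt N%:R * y) ^+ p - z N ^+ p)).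
  by move=> N0; rewrite mulrCA mulrBr Nxp// Nyp// -mulrBr mulrCA.
pose C : R := `|b' - b| * (expR (`|b'| * M1) + expR (`|b| * M1)) * C1.
pose Psi y : R := (b' - b) * (y ^+ p - w ^+ p) * expR (- (y ^+ 2 / 2)).
have bound N y : (0 < N)%N -> -1 <= y <= 1 ->
    `|Phi N y| <= C * expR (N%:R * cw_entropy y - c / 2 * N%:R * (y - 0) ^+ 2).
  move=> N0 y1; have e0 := moment_scale_gt0 p N N0.
  pose s := Num.sqrt N%:R * y.
  have s2 : s ^+ 2 = N%:R * y ^+ 2 by rewrite /s exprMn sqr_sqrtr.
  have Ed d cd : 0 < cd -> c <= cd -> (forall x : R, -1 <= x <= 1 ->
      d * x ^+ p - cw_entropy x <= - cd * x ^+ 2) ->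
      expR (N%:R * (d * (y ^+ p - x N ^+ p))) <=
      expR (`|d| * M1) * expR (N%:R * cw_entropy y - c * s ^+ 2).
    move=> cd0 ccd gapd; rewrite -expRD ler_expR.
    have -> : N%:R * (d * (y ^+ p - x N ^+ p)) =
        N%:R * (d * y ^+ p) - d * (moment_scale p N * z N ^+ p).
      by rewrite -Nxp//; ring.
    have h1 : N%:R * (d * y ^+ p) <= N%:R * cw_entropy y - c * s ^+ 2.
      rewrite s2 [X in _ - X]mulrCA -mulrBr ler_wpM2l//.
      have := gapd y y1; have : c * y ^+ 2 <= cd * y ^+ 2 by rewrite ler_wpM2r ?sqr_ge0.
      by lra.
    have h2 : - (d * (moment_scale p N * z N ^+ p)) <= `|d| * M1.
      rewrite (le_trans (ler_norm _))// normrN !normrM ler_wpM2l//.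
      by rewrite (gtr0_norm e0) -[leRHS]mul1r ler_pM ?moment_scale_le1// ltW.
    by lra.
  have E1 := Ed b c1 c10 _ gap1; have E2 := Ed b' c2 c20 _ gap2.
  have {}E1 := E1 (ltac:(by rewrite ge_min lexx)).
  have {}E2 := E2 (ltac:(by rewrite ge_min lexx orbT)).
  have h0 : `|Phi N y| <= `|b' - b| * (`|s| ^+ p + M1) *
      ((expR (`|b'| * M1) + expR (`|b| * M1)) * expR (N%:R * cw_entropy y - c * s ^+ 2)).
    rewrite /Phi normrM normfV (gtr0_norm e0) ler_pdivrMr//.
    apply: le_trans (ler_dist_expR _ _) _.
    have -> : `|N%:R * (b' * (y ^+ p - x N ^+ p)) - N%:R * (b * (y ^+ p - x N ^+ p))| =
       moment_scale p N * (`|b' - b| * `|s ^+ p - z N ^+ p|).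
      rewrite !Ty// -mulrBr -mulrBl -/s.
      by rewrite normrM (gtr0_norm e0) normrM.
    rewrite [leRHS]mulrC -[leLHS]mulrA ler_wpM2l ?(ltW e0)//.
    apply: ler_pM; rewrite ?mulr_ge0// ?addr_ge0 ?expR_ge0//.
      rewrite ler_wpM2l// (le_trans (ler_normB _ _))// normrX lerD//.
    by rewrite mulrDl lerD.
  apply: (le_trans h0).
  have -> : C * expR (N%:R * cw_entropy y - c / 2 * N%:R * (y - 0) ^+ 2) =
    `|b' - b| * (C1 * expR (c / 2 * s ^+ 2)) *
      ((expR (`|b'| * M1) + expR (`|b| * M1)) * expR (N%:R * cw_entropy y - c * s ^+ 2)).
    rewrite /C subr0 -(mulrA (c / 2)) -s2.
    have -> : expR (N%:R * cw_entropy y - c / 2 * s ^+ 2) =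
      expR (c / 2 * s ^+ 2) * expR (N%:R * cw_entropy y - c * s ^+ 2).
      by rewrite -expRD; congr expR; field.
    by ring.
  apply: ler_wpM2r; first by rewrite mulr_ge0 ?addr_ge0 ?expR_ge0.
  by rewrite ler_wpM2l.
have mPsi : measurable_fun setT Psi.
  apply: measurable_funM.
    by apply: measurable_funM => //; apply: measurable_funB => //; exact: measurable_funX.
  apply: measurableT_comp => //; apply: measurableT_comp => //.
  by apply: measurable_funM => //; exact: measurable_funX.
have PhiPsi : {ae mu, forall y, forall z' : nat -> R, z' @ \oo --> y ->
    Phi N (0 + z' N / Num.sqrt N%:R) *
      expR (- (N%:R * cw_entropy (0 + z' N / Num.sqrt N%:R))) @[N --> \oo] --> Psi y}.
  apply: aeW => y z' z'y; apply: cvgM; last first.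
    apply: continuous_cvg; first exact: continuous_expR.
    exact: cvgN (cvg_cw_entropy z' y z'y).
  have z'p : z' N ^+ p @[N --> \oo] --> y ^+ p.
    exact: (cvg_comp z' (fun y : R => y ^+ p) z'y (@exprn_continuous R p y)).
  have quot d : (expR (moment_scale p N * (d * (z' N ^+ p - z N ^+ p))) - 1) /
      moment_scale p N @[N --> \oo] --> d * (y ^+ p - w ^+ p).
    apply: (cvg_expR_quotient (moment_scale p)).
    - by move=> N; exact: moment_scale_gt0.
    - exact: cvg_moment_scale.
    - by apply: cvgMr; exact: cvgB.
  have lim : (expR (moment_scale p N * (b' * (z' N ^+ p - z N ^+ p))) - 1) / moment_scale p N -
      (expR (moment_scale p N * (b * (z' N ^+ p - z N ^+ p))) - 1) / moment_scale p N
      @[N --> \oo] --> (b' - b) * (y ^+ p - w ^+ p).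
    by rewrite mulrBl; apply: cvgB; exact: quot.
  move: lim; apply: cvg_trans; apply: near_eq_cvg; near=> N.
  have N0 : (0 < N)%N by near: N; exact: nbhs_infty_gt.
  have r0 : Num.sqrt N%:R != 0 :> R by rewrite gt_eqF// sqrtr_gt0 ltr0n.
  rewrite /= /Phi !Ty// (_ : Num.sqrt N%:R * (0 + z' N / Num.sqrt N%:R) = z' N).
    by rewrite -mulrBl; congr (_ * _); ring.
  by field.
have [_ lim] := laplace Phi Psi C (c / 2) c20' bound mPsi PhiPsi.
have PsiE y : Psi y = (b' - b) * S * (y ^+ p * normal_pdf 0 1 y - w ^+ p * normal_pdf 0 1 y).
  rewrite /Psi std_normal_pdfE -/S.
  by field; rewrite gt_eqF.
have intPsi : \int[mu]_y Psi y = (b' - b) * S * (normal_moment p - w ^+ p).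
  under eq_Rintegral do rewrite PsiE.
  have ipdf : mu.-integrable setT (fun y => (w ^+ p * normal_pdf 0 1 y)%:E).
    under eq_fun do rewrite EFinM.
    by apply: integrableZl => //; exact: integrable_normal_pdf.
  rewrite RintegralZl//; last first.
    rewrite /comp; under eq_fun do rewrite EFinB.
    by apply: integrableB => //; exact: integrable_normal_moment.
  rewrite RintegralB//; last exact: integrable_normal_moment.
  rewrite [X in _ * (_ - X)]RintegralZl//; last exact: integrable_normal_pdf.
  by rewrite [X in _ ^+ _ * X]/Rintegral integral_normal_pdf mulr1.
move: lim; rewrite intPsi.
have -> : kappa * ((b' - b) * S * (normal_moment p - w ^+ p)) =
   kappa * S * ((b' - b) * (normal_moment p - w ^+ p)) by ring.
apply: cvg_trans; apply: near_eq_cvg; near=> N.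
rewrite /inv_likelihood -config_avgB mulrC -config_avgZ; congr config_avg.
apply/funext => y; rewrite /Phi -/(x N) !mul0r !addr0.
by rewrite mulrC.
Unshelve. all: end_near. Qed.

(* To first order in [moment_scale], the likelihood increases between two
   subcritical parameters exactly when [w ^ p] exceeds the Gaussian moment. *)
Lemma inv_likelihood_lt p b b' (z : nat -> R) (w : R) : (2 < p)%N ->
  quad_gap p b -> quad_gap p b' -> z @ \oo --> w ->
  (b' - b) * (normal_moment p - w ^+ p) < 0 ->
  \forall N \near \oo, inv_likelihood 0 p N (0 + z N / Num.sqrt N%:R) b' <
    inv_likelihood 0 p N (0 + z N / Num.sqrt N%:R) b.
Proof.
move=> p2 gb gb' zw neg.
have [kappa kappa0 /(_ z w zw) lim] := cvg_inv_likelihoodB p b b' p2 gb gb'.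
have neg' : kappa * ((b' - b) * (normal_moment p - w ^+ p)) < 0 by rewrite pmulr_rlt0.
near=> N; rewrite -subr_lt0.
have e0 : 0 < moment_scale p N.
  by apply: moment_scale_gt0; near: N; exact: nbhs_infty_gt.
have ei : 0 < (moment_scale p N)^-1 by rewrite invr_gt0.
rewrite -(pmulr_llt0 _ ei).
by near: N; exact: cvgr_lt _ lim _ neg'.
Unshelve. all: end_near. Qed.

(** H exceeds some d > 0 near x0. A penalty lam (y - x0)^2 extends this to a minorant of the weight
    on all of [-1, 1], exp (N d) times a function whose average has a positive limit by Laplace's
    method at x0. *)
Lemma cw_partition_diverges b p (x0 : R) : -1 < x0 < 1 ->
  0 < b * x0 ^+ p - cw_entropy x0 -> forall M, \forall N \near \oo,
  M <= cw_partition b 0 p N.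
Proof.
move=> x01 Hx0 M.
have HE y : cw_H b 0 p y = b * y ^+ p - cw_entropy y by rewrite /cw_H mul0r addr0.
rewrite -HE in Hx0; pose d := cw_H b 0 p x0 / 2.
have d0 : 0 < d by rewrite divr_gt0.
have [r /= r0 rH] : exists2 r : R, 0 < r & forall y, `|x0 - y| < r -> d < cw_H b 0 p y.
  have dH : d < cw_H b 0 p x0 by rewrite /d; lra.
  have /nbhs_ballP[r /= r0 rH] : \forall t \near x0, d < cw_H b 0 p t.
    by apply: (cvgr_gt _ (continuous_cw_H b 0 p x0)).
  by exists r => // y yr; exact: rH.
have N11 : -1 <= (1 : R) by lra.
have [a _ aH] := EVT_min N11 (continuous_subspaceT (continuous_cw_H b 0 p)).
pose B := cw_H b 0 p a.
(* At distance at least r from x0 the penalty exceeds d - B, where B is the minimum of H. *)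
pose lam := (`|d - B| + 1) / r ^+ 2.
have lam0 : 0 < lam by rewrite divr_gt0 ?exprn_gt0// ltr_wpDl.
have lamH y : -1 <= y <= 1 -> d <= cw_H b 0 p y + lam * (y - x0) ^+ 2.
  move=> y1; have [yr|ry] := ltP `|x0 - y| r.
    apply: ler_wpDr; first by rewrite mulr_ge0 ?sqr_ge0// ltW.
    exact/ltW/rH.
  have yB : B <= cw_H b 0 p y by apply: aH; rewrite in_itv.
  have : `|d - B| + 1 <= lam * (y - x0) ^+ 2.
    rewrite /lam mulrAC ler_pdivlMr ?exprn_gt0// ler_wpM2l ?addr_ge0//.
    by rewrite -[leRHS]real_normK ?num_real// distrC ler_pXn2r ?nnegrE// ltW.
  by have := ler_norm (d - B); lra.
have [kappa kappa0 laplace] := laplace_config_avg x0 x01.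
(* [lam] is so large that [expR (N d) * Phi N] is below the weight everywhere. *)
pose Phi N y : R := expR (N%:R * cw_entropy y - lam * N%:R * (y - x0) ^+ 2).
pose v : R := (2 * lam)^-1.
have v0 : 0 < v by rewrite invr_gt0 mulr_gt0.
pose Psi y : R := expR (- (y ^+ 2 / (2 * v)) + 0 * y).
have [] := laplace Phi Psi 1 lam lam0.
- by move=> N y N0 y1; rewrite mul1r ger0_norm ?expR_ge0.
- apply: measurableT_comp => //; apply: measurable_funD; last exact: measurable_funM.
  apply: measurableT_comp => //; apply: measurable_funM => //; exact: measurable_funX.
- apply: aeW => w z zw.
  have lim : expR (- (z N ^+ 2 / (2 * v)) + 0 * z N) @[N --> \oo] --> Psi w.
    apply: continuous_cvg; first exact: continuous_expR.
    apply: cvgD; last exact: cvgMr.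
    apply: cvgN; apply: cvgMl.
    exact: (cvg_comp z (fun y : R => y ^+ 2) zw (@exprn_continuous R 2 w)).
  move: lim; apply: cvg_trans; apply: near_eq_cvg; near=> N.
  have N0 : (0 < N)%N by near: N; exact: nbhs_infty_gt.
  have N0' : 0 < N%:R :> R by rewrite ltr0n.
  rewrite /= /Phi -expRD; congr expR.
  rewrite (_ : x0 + z N / Num.sqrt N%:R - x0 = z N / Num.sqrt N%:R);
    last by rewrite addrC addKr.
  rewrite expr_div_n sqr_sqrtr// /v; field.
  by rewrite !gt_eqF.
move=> _; rewrite Rintegral_gauss_tilt// expr0n/= !mul0r expR0 mulr1.
set L := kappa * _ => lim.
have L0 : 0 < L.
  by rewrite mulr_gt0// sqrtr_gt0 pmulrn_lgt0// mulr_gt0// pi_gt0.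
have L20 : L / 2 < L by lra.
near=> N; have N0 : (0 < N)%N by near: N; exact: nbhs_infty_gt.
have PhiL : L / 2 <= config_avg N (Phi N).
  by apply: ltW; near: N; exact: cvgr_gt _ lim _ L20.
apply: (@le_trans _ _ (expR (N%:R * d) * config_avg N (Phi N))); last first.
  rewrite -config_avgZ cw_partitionE; apply: ler_config_avg => y y1.
  rewrite -expRD ler_expR mul0r addr0.
  have := lamH y y1; rewrite HE => h.
  have := ler_wpM2l (ler0n R N) h; lra.
apply: (@le_trans _ _ ((N%:R * d) * (L / 2))).
  have dL0 : 0 < d * (L / 2) by rewrite mulr_gt0// divr_gt0.
  rewrite -mulrA -(ler_pdivrMr _ _ dL0).
  by near: N; exact: nbhs_infty_ger.
apply: ler_pM => //.
- by rewrite mulr_ge0// ltW.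
- by rewrite divr_ge0// ltW.
- by rewrite (le_trans _ (expR_ge1Dx _))// lerDr.
Unshelve. all: end_near. Qed.

(** The parameter 0 is the reference because the inverse likelihood is 1 there. At b it is the
    partition function times exp (- N b x^p), and N x^p tends to 0. *)
Lemma inv_likelihood_diverges b p (x0 : R) (z : nat -> R) (w : R) : (2 < p)%N ->
  -1 < x0 < 1 -> 0 < b * x0 ^+ p - cw_entropy x0 -> z @ \oo --> w ->
  \forall N \near \oo, inv_likelihood 0 p N (0 + z N / Num.sqrt N%:R) 0 <
    inv_likelihood 0 p N (0 + z N / Num.sqrt N%:R) b.
Proof.
move=> p2 x01 Hx0 zw.
have zp : b * (moment_scale p N * z N ^+ p) @[N --> \oo] --> b * (0 * w ^+ p).
  apply: cvgMr; apply: cvgM; first exact: cvg_moment_scale.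
  exact: (cvg_comp z (fun y : R => y ^+ p) zw (@exprn_continuous R p w)).
have zp1 : b * (0 * w ^+ p) < 1 by rewrite mul0r mulr0.
near=> N; have N0 : (0 < N)%N by near: N; exact: nbhs_infty_gt.
have -> : inv_likelihood 0 p N (0 + z N / Num.sqrt N%:R) 0 = 1.
  rewrite /inv_likelihood /config_avg.
  under eq_bigr do rewrite !mul0r addr0 mulr0 expR0.
  by rewrite sumr_const card_ffun card_bool card_ord natrX mulVf// expf_neq0.
rewrite inv_likelihoodE mul0r addr0 mulrCA add0r moment_scaleE//.
rewrite expRN ltr_pdivlMr ?expR_gt0// mul1r.
apply: (@lt_le_trans _ _ (expR 1)).
  by rewrite ltr_expR; near: N; exact: cvgr_lt _ zp _ zp1.
by near: N; exact: cw_partition_diverges x01 Hx0 _.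
Unshelve. all: end_near. Qed.

(** Two subcritical parameters just below [beta_tilde] bound the estimate from below; divergence at
    [beta_tilde p + e] bounds it from above. *)
Lemma cvg_mle_of_upper p (z : nat -> R) (w : R) : (2 < p)%N -> 0 < @beta_tilde R p ->
  z @ \oo --> w -> normal_moment p < w ^+ p ->
  mle_of 0 p N (0 + z N / Num.sqrt N%:R) @[N --> \oo] --> (beta_tilde p)%:E.
Proof.
move=> p2 bt0 zw wp; set bt := beta_tilde p in bt0 *.
have p0 : (0 < p)%N by exact: ltn_trans p2.
apply: cvge_between => e e0.
(* Keeps both parameters nonnegative, hence of absolute value below [beta_tilde]. *)
pose d := Num.min e bt.
have d0 : 0 < d by rewrite lt_min e0.
have de : d <= e by rewrite ge_min lexx.
have db : d <= bt by rewrite ge_min lexx orbT.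
have g1 : quad_gap p (bt - d / 2) by apply: beta_tilde_gap => //; rewrite ger0_norm -/bt; lra.
have g2 : quad_gap p (bt - d / 4) by apply: beta_tilde_gap => //; rewrite ger0_norm -/bt; lra.
have neg : (bt - d / 4 - (bt - d / 2)) * (normal_moment p - w ^+ p) < 0.
  by rewrite pmulr_rlt0; lra.
have low := inv_likelihood_lt p _ _ z w p2 g1 g2 zw neg.
have bte : bt < bt + e by lra.
have [x [x0 x1 Hx]] := beta_tilde_lt_pos _ _ p0 bte.
have x01 : -1 < x < 1 by lra.
have up := inv_likelihood_diverges _ p x z w p2 x01 Hx zw.
apply: filterS2 low up => N low up; split.
  apply: (@le_trans _ _ (bt - d / 2)%:E); first by rewrite lee_fin; lra.
  by apply: mle_of_ge low; lra.
by apply: mle_of_le up; lra.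
Qed.

(** The mirror image: for p odd, the pairs (b, x) and (- b, - x) give the same exponent. *)
Lemma cvg_mle_of_lower_odd p (z : nat -> R) (w : R) : (2 < p)%N -> odd p ->
  0 < @beta_tilde R p -> z @ \oo --> w -> w ^+ p < normal_moment p ->
  mle_of 0 p N (0 + z N / Num.sqrt N%:R) @[N --> \oo] --> (- beta_tilde p)%:E.
Proof.
move=> p2 op bt0 zw wp; set bt := beta_tilde p in bt0 *.
have p0 : (0 < p)%N by exact: ltn_trans p2.
apply: cvge_between => e e0.
pose d := Num.min e bt.
have d0 : 0 < d by rewrite lt_min e0.
have de : d <= e by rewrite ge_min lexx.
have db : d <= bt by rewrite ge_min lexx orbT.
have g1 : quad_gap p (- (bt - d / 2)).
  by apply: beta_tilde_gap => //; rewrite normrN ger0_norm -/bt; lra.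
have g2 : quad_gap p (- (bt - d / 4)).
  by apply: beta_tilde_gap => //; rewrite normrN ger0_norm -/bt; lra.
have neg : (- (bt - d / 4) - - (bt - d / 2)) * (normal_moment p - w ^+ p) < 0.
  by rewrite nmulr_rlt0; lra.
have up := inv_likelihood_lt p _ _ z w p2 g1 g2 zw neg.
have bte : bt < bt + e by lra.
have [x [x0 x1 Hx]] := beta_tilde_lt_pos _ _ p0 bte.
have x01 : -1 < - x < 1 by lra.
have Hx' : 0 < - (bt + e) * (- x) ^+ p - cw_entropy (- x).
  by rewrite cw_entropyN exprNn -signr_odd op expr1 mulN1r mulrNN.
have low := inv_likelihood_diverges _ p (- x) z w p2 x01 Hx' zw.
apply: filterS2 low up => N low up; split.
  have -> : - bt - e = - (bt + e) by ring.
  by apply: mle_of_ge low; lra.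
apply: (@le_trans _ _ (- (bt - d / 2))%:E); last by rewrite lee_fin; lra.
by apply: mle_of_le up; lra.
Qed.

(** For p even every b <= 0 is subcritical, so the comparison can be made arbitrarily far to the
    left. *)
Lemma cvg_mle_of_lower_even p (z : nat -> R) (w : R) : (2 < p)%N -> ~~ odd p ->
  z @ \oo --> w -> w ^+ p < normal_moment p ->
  mle_of 0 p N (0 + z N / Num.sqrt N%:R) @[N --> \oo] --> (-oo)%E.
Proof.
move=> p2 ep zw wp; apply/cvgeNyPle => A.
pose a := Num.min A 0.
have aA : a <= A by rewrite ge_min lexx.
have a0 : a <= 0 by rewrite ge_min lexx orbT.
have g1 : quad_gap p a by exact: even_gap.
have g2 : quad_gap p (a - 1) by apply: even_gap => //; lra.
have neg : (a - 1 - a) * (normal_moment p - w ^+ p) < 0 by rewrite nmulr_rlt0; lra.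
have up := inv_likelihood_lt p _ _ z w p2 g1 g2 zw neg.
apply: filterS up => N up.
apply: (@le_trans _ _ a%:E); last by rewrite lee_fin.
by apply: mle_of_le up; lra.
Qed.

End zero_magnetization.

(** * The two-point limit law *)

Section limit_mixture.
Context {R : realType}.
Notation mu := (@lebesgue_measure R).
Implicit Types (b x : R) (p N : nat).

(** Two solutions have the same absolute value, so there are at most two. This discards the tie w^p
    = E Z^p. *)
Lemma negligible_expn_eq p (K : R) : (0 < p)%N ->
  exists A : set R, [/\ measurable A, mu A = 0%E & [set w | w ^+ p = K] `<=` A].
Proof.
move=> p0; have [[w0 w0K]|noK] := pselect (exists w0 : R, w0 ^+ p = K); last first.
  by exists set0; split=> // w wK; apply: noK; exists w.
have fin : finite_set [set w0; - w0] by rewrite finite_setU; split; exact: finite_set1.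
exists [set w0; - w0]; split.
- by apply: measurableU; exact: measurable_set1.
- exact/countable_lebesgue_measure0/finite_set_countable.
- move=> w /= wK.
  have : `|w| = `|w0|.
    apply: (@pexpIrn _ p); rewrite ?nnegrE//.
    by rewrite -!normrX wK w0K.
  by move/eqP; rewrite eqr_norm2 => /orP[]/eqP; [left|right].
Qed.

Lemma integral_mixture (w : {i01 R}) (x y : \bar R) (f : \bar R -> R) :
  measurable_fun setT f ->
  (\int[mixture w (point_mass x) (point_mass y)]_z (f z)%:E =
   (w%:num * f x + (1 - w%:num) * f y)%:E)%E.
Proof.
move=> mf; have mf' : measurable_fun setT (EFin \o f) by exact/measurable_EFinP.
have ge0 (g : \bar R -> R) : measurable_fun setT g -> (forall z, 0 <= g z) ->
    (\int[mixture w (point_mass x) (point_mass y)]_z (g z)%:E =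
     (w%:num * g x + (1 - w%:num) * g y)%:E)%E.
  move=> mg g0; have mg' : measurable_fun setT (EFin \o g) by exact/measurable_EFinP.
  rewrite /mixture ge0_integral_measure_add//; last by move=> z _; rewrite lee_fin.
  rewrite !ge0_integral_mscale//=; try by move=> z _; rewrite lee_fin.
  rewrite !integral_dirac// !diracT !mul1e.
  by rewrite -!EFinM -EFinD.
rewrite integralE.
have -> : ((fun z => (f z)%:E)^\+ = (fun z => (Num.max (f z) 0)%:E))%E.
  by apply/funext => z; rewrite funeposE EFin_max.
have -> : ((fun z => (f z)%:E)^\- = (fun z => (Num.max (- f z) 0)%:E))%E.
  by apply/funext => z; rewrite funenegE EFin_max.
rewrite !ge0.
- rewrite -EFinB; congr EFin.
  have maxB (t : R) : Num.max t 0 - Num.max (- t) 0 = t.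
    have [t0|t0] := leP 0 t.
      by rewrite max_r ?oppr_le0// subr0.
    by rewrite max_l ?oppr_ge0 ?(ltW t0)// sub0r opprK.
  rewrite -[in RHS](maxB (f x)) -[in RHS](maxB (f y)); ring.
- by apply: measurable_maxr => //; exact: measurableT_comp.
- by move=> z; rewrite le_max lexx orbT.
- exact: measurable_maxr.
- by move=> z; rewrite le_max lexx orbT.
Qed.

Lemma gammaE p :
  gamma p = fine (normal_prob 0 1 [set z : R | z ^+ p <= normal_moment p]).
Proof.
rewrite /gamma; congr (fine (_ _)); apply/seteqP.
have -> : ('E_(@std_normal R)[fun z : R => (z ^+ p)%R] = (normal_moment p)%:E)%E.
  rewrite unlock /std_normal.
  rewrite (integral_normal_prob 0 1 (fun z : R => z ^+ p)).
  - rewrite /normal_moment /Rintegral fineK//.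
    exact: integrable_fin_num (integrable_normal_moment p).
  - exact: measurable_funX.
  - exact: integrable_normal_moment.
by split=> z /=; rewrite lee_fin.
Qed.

Lemma measurable_expn_le p (K : R) : measurable [set z : R | z ^+ p <= K].
Proof.
rewrite -[X in measurable X]setTI.
have -> : [set z : R | z ^+ p <= K] = (fun z : R => z ^+ p) @^-1` `]-oo, K].
  by apply/seteqP; split => z /=; rewrite in_itv.
by apply: measurable_funX.
Qed.

Lemma normal_moment_odd p : odd p -> @normal_moment R p = 0.
Proof.
move=> op; have ip := @integrable_normal_moment R p.
have fin := integrable_fin_num measurableT ip.
have := integral_reflect (fun y => y ^+ p * normal_pdf 0 1 y) ip.
have -> : (\int[mu]_y ((- y) ^+ p * normal_pdf 0 1 (- y))%:E =
    - \int[mu]_y (y ^+ p * normal_pdf 0 1 y)%:E)%E.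
  rewrite -integralN/=; last exact: integrable_add_def.
  apply: eq_integral => y _.
  by rewrite !std_normal_pdfE sqrrN exprNn -signr_odd op expr1 mulN1r mulNr.
rewrite /normal_moment /Rintegral -(fineK fin) -EFinN => -[] /=; lra.
Qed.

(** The moment being 0, the event is z <= 0, which reflection exchanges with its complement up to a
    null set. *)
Lemma gamma_odd p : odd p -> @gamma R p = 2^-1.
Proof.
move=> op; rewrite gammaE (normal_moment_odd p op).
set A := [set z | _].
have AE : A = `]-oo, 0]%classic.
  by apply/seteqP; split => z; rewrite /A /= in_itv/= exprn_odd_le0.
have mA : measurable A := measurable_expn_le p 0.
have mpdf (D : set R) : measurable_fun D (fun x => (normal_pdf (0 : R) 1 x)%:E).
  by apply/measurable_EFinP/measurable_funTS; exact: measurable_normal_pdf.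
have CA : normal_prob 0 1 (~` A) = normal_prob 0 1 A.
  rewrite AE setCitvl /normal_prob integral_itv_obnd_cbnd//.
  rewrite ge0_integration_by_substitution0; last 2 first.
  - exact: mpdf.
  - by move=> r; rewrite lee_fin normal_pdf_ge0.
  by apply: eq_integral => x _; rewrite !std_normal_pdfE sqrrN.
have : normal_prob 0 1 (~` A) = (1 - normal_prob 0 1 A)%E by exact: probability_setC.
rewrite CA.
have /fineK <- : normal_prob 0 1 A \is a fin_num by exact: fin_num_measure.
rewrite -EFinB => -[] /= h; lra.
Qed.

(** Common to both parities, which differ only in the limit [Xm] on the side w^p < E Z^p. For p >= 3
    the second derivative of H at 0 is -1 whatever b, so w is standard normal. *)
Theorem mle_limit_zero p b (Xm Xp : \bar R) : (2 < p)%N -> 0 <= b ->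
  b < beta_tilde p ->
  (forall (z : nat -> R) (w : R), z @ \oo --> w -> w ^+ p < normal_moment p ->
    mle_of 0 p N (0 + z N / Num.sqrt N%:R) @[N --> \oo] --> Xm) ->
  (forall (z : nat -> R) (w : R), z @ \oo --> w -> normal_moment p < w ^+ p ->
    mle_of 0 p N (0 + z N / Num.sqrt N%:R) @[N --> \oo] --> Xp) ->
  cvg_in_law (@cw_prob R b 0 p) (@mle R 0 p)
    (mixture (gamma01 p) (point_mass Xm) (point_mass Xp)).
Proof.
move=> p2 b0 bb lower upper f cf fbnd; have p0 : (0 < p)%N by exact: ltn_trans p2.
have [B fB] : exists B : R, forall x : \bar R, `|f x| <= B.
  have [M [_ Mf]] := fbnd; exists (M + 1) => y.
  by apply: Mf => //; rewrite ltrDl.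
have mf := measurable_continuous_ereal f cf.
have m1 : -1 < (0 : R) < 1 by lra.
have dH0 : cw_dH b 0 p 0 = 0.
  rewrite /cw_dH /cw_dentropy !addr0 subr0 subrr mulr0 subr0 expr0n.
  by case: p p2 {bb lower upper p0} => [|[|q]]//= _; rewrite !mulr0.
have ddH0 : cw_ddH b p 0 = -1.
  rewrite /cw_ddH !expr0n subr0 invr1.
  by case: p p2 {bb lower upper p0 dH0} => [|[|[|q]]]//= _; rewrite !mulr0 sub0r.
have [c c0 gap] : quad_gap p b by apply: beta_tilde_gap => //; rewrite ger0_norm.
have gap' (x : R) : -1 <= x <= 1 -> cw_H b 0 p x - cw_H b 0 p 0 <= - c * (x - 0) ^+ 2.
  by move=> x1; rewrite cw_H0// !subr0 /cw_H mul0r addr0; exact: gap.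
have ddHn : cw_ddH b p 0 < 0 by rewrite ddH0; lra.
pose K := @normal_moment R p.
pose g w := if w ^+ p <= K then f Xm else f Xp.
have gB w : `|g w| <= B by rewrite /g; case: ifP.
have gE w : g w = f Xp + (f Xm - f Xp) * \1_[set z : R | z ^+ p <= K] w.
  rewrite /g indicE; case: ifPn => wK.
    by rewrite mem_set//= mulr1 addrC subrK.
  by rewrite memNset ?mulr0 ?addr0//=; exact/negP.
have mA := measurable_expn_le p K.
have mg : measurable_fun setT g.
  rewrite (funext gE); apply: measurable_funD => //; apply: measurable_funM => //.
have ae : {ae mu, forall w, forall z : nat -> R, z @ \oo --> w ->
    f (mle_of 0 p N (0 + z N / Num.sqrt N%:R)) @[N --> \oo] --> g w}.
  have [A [mA' A0 sA]] := negligible_expn_eq p K p0.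
  exists A; split => // w /= nw; apply: sA => /=; apply: contrapT => wK; apply: nw.
  move=> z zw; rewrite /g; case: (ltgtP (w ^+ p) K) => // wpK.
  - by apply: (cvg_comp _ f); [exact: lower zw wpK|exact: cf].
  - by apply: (cvg_comp _ f); [exact: upper zw wpK|exact: cf].
have := cvg_expectation b 0 p 0 c m1 dH0 c0 gap' ddHn
  (fun N y => f (mle_of 0 p N y)) g B (fun N y => fB _) gB mg ae.
rewrite ddH0 opprK invr1 sqrtr1 integral_mixture//.
rewrite -(integral_normal_prob 0 1 g mg); last exact: integrable_bounded_normal gB.
suff -> : (\int[normal_prob 0 1]_w (g w)%:E =
    ((gamma01 p)%:num * f Xm + (1 - (gamma01 p)%:num) * f Xp)%:E)%E by [].
under eq_integral do rewrite gE EFinD EFinM.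
have iA : (normal_prob 0 1).-integrable setT
    (fun w : R => (\1_[set z : R | z ^+ p <= K] w)%:E).
  exact: integrable_indic.
rewrite integralD//; last 2 first.
- by apply: finite_measure_integrable_cst.
- exact: integrableZl.
rewrite integral_cst// integralZl// integral_indic// setIT.
rewrite [X in ((f Xp)%:E * X)%E](_ : _ = 1%E); last exact: probability_setT.
rewrite [X in ((f Xm - f Xp)%:E * X)%E](_ : _ = (gamma p)%:E); last first.
  by rewrite gammaE; apply/esym/fineK; exact: fin_num_measure.
rewrite mule1 -EFinM -EFinD; congr EFin; rewrite /=; ring.
Qed.

End limit_mixture.

Theorem theorem2p4 (R : realType) (p : nat) (hp : (3 <= p)%N)
  (beta h : R) (hbeta : 0 <= beta) (hreg : p_regular beta h p)
  (m : R) (hm : cw_maximizers beta h p = [set m]) :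
  [/\ m != 0 ->
        cvg_in_law (@cw_prob R beta h p)
          (fun N s => ((Num.sqrt N%:R)%:E * (mle h p s - beta%:E))%E)
          (normal_law (- (cw_H beta h p)^`(2)%classic m /
                       (p%:R ^+ 2 * m ^+ (2 * p - 2)))),
      m = 0 <-> h = 0 /\ beta < beta_tilde p &
      m = 0 ->
        cvg_in_law (@cw_prob R beta h p) (@mle R h p)
          (if odd p
           then mixture half01 (point_mass (beta_tilde p)%:E)
                                    (point_mass (- beta_tilde p)%:E)
           else mixture (gamma01 p) (point_mass -oo%E)
                                    (point_mass (beta_tilde p)%:E))].
Proof.
have zero_iff := maximizer0P _ _ _ _ hp hbeta hreg hm.
split=> // [mn0|m0].
- have [m' [hm' m'1 H2]] := hreg.
  have mm : m' = m by have : [set m'] m by rewrite -hm' hm.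
  have m1 : -1 < m < 1 by move: m'1; rewrite mm in_itv.
  have p0 : (0 < p)%N by exact: leq_trans hp.
  have ddH : cw_ddH beta p m < 0 by move: H2; rewrite mm cw_H_derive2.
  rewrite cw_H_derive2//; exact: (mle_clt beta h p m p0 m1 mn0 ddH hm).
- have [h0 bb] := zero_iff.1 m0; rewrite h0.
  have bt0 := le_lt_trans hbeta bb.
  have upper := cvg_mle_of_upper p _ _ hp bt0.
  case: ifPn => op.
    have lower := cvg_mle_of_lower_odd p _ _ hp op bt0.
    have lim := mle_limit_zero p beta _ _ hp hbeta bb lower upper.
    (* The general limit lists the lower point first and the statement the upper one; with weight
       1/2 the mixtures agree on test functions. *)
    move=> f cf fbnd; have mf := measurable_continuous_ereal f cf.
    have := lim f cf fbnd; rewrite !integral_mixture//= (gamma_odd p op).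
    set u := f (- _)%:E; set v := f (_)%:E.
    by have -> : 2^-1 * v + (1 - 2^-1) * u = 2^-1 * u + (1 - 2^-1) * v by field.
  have lower := fun z w => @cvg_mle_of_lower_even R p z w hp op.
  have lim := mle_limit_zero p beta _ _ hp hbeta bb lower upper.
  exact: lim.
Qed.
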